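(* For every even integer $n\ge 18$ there exists a simple, nonplanar, bipartite, $3$-connected cubic graph $G$ with $n$ vertices and $K'(G,3)=1$.
   Context: A proper $3$-edge coloring assigns colors from $\{1,2,3\}$ to edges so that adjacent edges receive different colors. For colors $a\neq b$, an edge-Kempe chain is a connected component of the subgraph of edges colored $a$ or $b$; an edge-Kempe switch interchanges $a$ and $b$ on one chain. $K'(G,3)$ is the number of equivalence classes of proper $3$-edge colorings of $G$ under the equivalence relation generated by edge-Kempe switches. *)

(* Defs.v *)
From mathcomp Require Import all_boot all_order all_fingroup.
Set Implicit Arguments. Unset Strict Implicit. Unset Printing Implicit Defensive.

(* A finite simple graph is a relation [e : rel T] on a finType T,
   required (in the theorem) to be symmetric and irreflexive. *)

Section Graphs.
Variables (T : finType) (e : rel T).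

Definition cubic : Prop := forall x : T, #|[set y | e x y]| = 3.

Definition bipartite : Prop :=
  exists side : T -> bool, forall x y, e x y -> side x != side y.

Definition connected_on (S : {set T}) : Prop :=
  forall x y, x \in S -> y \in S ->
    connect [rel u v | [&& e u v, u \in S & v \in S]] x y.

Definition k_connected (k : nat) : Prop :=
  k < #|T| /\ forall X : {set T}, #|X| < k -> connected_on (~: X).

Definition edges : {set {set T}} := [set [set p.1; p.2] | p : T * T & e p.1 p.2].

Local Notation edgeT := {A : {set T} | A \in edges}.

Local Notation dart := {p : T * T | e p.1 p.2 && e p.2 p.1}.

Lemma rev_dart_proof (d : dart) : e (val d).2 (val d).1 && e (val d).1 (val d).2.
Proof. by case: d => [[x y]] /= /andP[-> ->]. Qed.

Definition rev_dart (d : dart) : dart :=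
  exist (fun p : T * T => e p.1 p.2 && e p.2 p.1) ((val d).2, (val d).1) (rev_dart_proof d).

Lemma rev_dartK : involutive rev_dart.
Proof. by move=> d; apply: val_inj; case: d => [[x y]]. Qed.

Definition alpha : {perm dart} := perm (inv_inj rev_dartK).

Definition isolated : {set T} := [set x | [forall y, ~~ e x y]].

(* A rotation system sigma: a permutation of the darts preserving the tail
   vertex and cyclically permuting all darts at each vertex.  Its faces are
   the cycles of alpha * sigma (d |-> sigma (alpha d)); each isolated vertex
   carries one face.  The graph is planar iff some rotation system has Euler
   characteristic 2 on every connected component, i.e.
   V - E + F = 2 * (#components). *)
Definition planar : Prop :=
  exists sigma : {perm dart},
    [/\ (forall d, (val (sigma d)).1 = (val d).1),
        (forall d d', (val d).1 = (val d').1 -> d' \in porbit sigma d) &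
        #|T| + (#|porbits (alpha * sigma)| + #|isolated|)
          = #|edges| + 2 * n_comp [rel x y | e x y || e y x] T].

Definition adj_edges (f g : edgeT) : bool := (f != g) && (val f :&: val g != set0).

Definition proper3 (c : {ffun edgeT -> 'I_3}) : bool :=
  [forall f, forall g, adj_edges f g ==> (c f != c g)].

Definition ab_rel (c : {ffun edgeT -> 'I_3}) (a b : 'I_3) : rel edgeT :=
  fun f g => [&& adj_edges f g, c f \in [set a; b] & c g \in [set a; b]].

Definition kempe_switch (c : {ffun edgeT -> 'I_3}) (a b : 'I_3) (f0 : edgeT)
  : {ffun edgeT -> 'I_3} :=
  [ffun g => if connect (ab_rel c a b) f0 g
             then (if c g == a then b else a) else c g].

Definition kempe_step (c c' : {ffun edgeT -> 'I_3}) : bool :=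
  [&& proper3 c, proper3 c' &
      [exists a, exists b, exists f0,
         [&& a != b, c f0 \in [set a; b] & c' == kempe_switch c a b f0]]].

Definition kempe_equiv : rel {ffun edgeT -> 'I_3} :=
  connect (fun c c' => kempe_step c c' || kempe_step c' c).

Definition Kprime3 : nat :=
  #|[set [set d | proper3 d && kempe_equiv c d] | c in [pred c | proper3 c]]|.

End Graphs.

(* Main.v *)
Require Import Defs.
From mathcomp Require Import all_boot all_order all_fingroup all_algebra zify.
Set Implicit Arguments. Unset Strict Implicit. Unset Printing Implicit Defensive.

(* Replacing a vertex of a cubic graph by a cube minus a vertex adds six
   vertices, so suitable graphs on 12, 16 and 20 vertices generate all orders.

   Two colourings with a common colour class are Kempe equivalent, and so are
   two colourings that differ by a permutation of the colours.  By parity the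
   three edges leaving the inserted piece have different colours, so a
   colouring of the new graph contracts to one of the old graph; it shares a
   colour class with the extension of its contraction that is constant on the
   parallel classes of the cube, and this extension commutes with colour
   permutations.  Hence a single Kempe class remains.

   The base graphs contain a subdivision of K_{3,3} avoiding the vertex that
   is replaced, and it survives.  Nonplanarity follows from a form of MacLane's
   criterion: if Euler's formula holds, every even edge set is the boundary of
   a set of faces.  Merging the faces that meet along edges outside the
   subdivision therefore yields at least five regions.  Each region boundary
   contains a cycle, hence at least four of the nine branches, but a branch
   lies on at most two region boundaries, and 5 * 4 > 2 * 9. *)

(** * Kempe equivalence through shared colour classes *)

Section KempeClasses.
Variables (T : finType) (e : rel T).
Local Notation edgeT := {A : {set T} | A \in edges e}.

Lemma kempe_equiv_trans : transitive (@kempe_equiv T e).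
Proof. exact: connect_trans. Qed.

Lemma third_color (a b w x : 'I_3) :
  a != b -> a != w -> b != w -> x != w -> (x == a) || (x == b).
Proof. by move: a b w x; do 4 (case; case => [|[|[|//]]] ?). Qed.

(* The colours [a], [b] of [d] are those of [c] swapped on every chain where
   they disagree, so switching the chain of a disagreeing edge brings [c]
   closer to [d]. *)
Lemma kempe_equiv_same_class (c d : {ffun edgeT -> 'I_3}) (w : 'I_3) :
  proper3 c -> proper3 d -> (forall f, (c f == w) = (d f == w)) ->
  kempe_equiv c d.
Proof.
have [N] := ubnP #|[set f | c f != d f]|.
elim: N c => // N IHN c; rewrite ltnS => leN pc pd cd.
case: (pickP [pred f | c f != d f]) => [f0 /= nf0 | E]; last first.
  suff -> : c = d by exact: connect0.
  by apply/ffunP => f; move/negbFE: (E f) => /eqP.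
set a := c f0; set b := d f0.
have aw : a != w.
  by apply/negP => /[dup] aw; rewrite cd => /eqP dw; case/negP: nf0; rewrite dw.
have bw : b != w by rewrite -cd.
pose c' := kempe_switch c a b f0.
have P f g : adj_edges f g -> c f != c g /\ d f != d g.
  move=> fg; split.
    by move/forallP: pc => /(_ f) /forallP /(_ g) /implyP /(_ fg).
  by move/forallP: pd => /(_ f) /forallP /(_ g) /implyP /(_ fg) ->.
have adjC f g : @adj_edges T e f g = adj_edges g f.
  by rewrite /adj_edges eq_sym setIC.
have inab x : (x \in [set a; b]) = (x != w).
  rewrite !inE; apply/idP/idP => [/orP[]/eqP-> //|xw].
  exact: (third_color nf0 aw bw xw).
(* Along the chain [c] and [d] stay swapped: [d] too uses only [a] and [b] there, so properness
   propagates the swap from an edge to the next. *)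
have on g : connect (ab_rel c a b) f0 g ->
    c g \in [set a; b] /\ d g = (if c g == a then b else a).
  move=> /connectP[p]; elim/last_ind: p g => [g _ ->|p h IH g].
    by rewrite /= !inE eqxx; split; rewrite ?eqxx.
  rewrite rcons_path last_rcons => /andP[pp hg ->].
  have [ch dh] := IH _ pp erefl.
  move: hg; rewrite /ab_rel => /and3P[/P[ncd ndd] _ cg]; split=> //.
  set l := last f0 p in ch dh ncd ndd *.
  have dg : d h \in [set a; b] by rewrite inab -cd -inab.
  move: ch cg dg ncd ndd; rewrite dh !inE.
  case/orP => /eqP->; case/orP => /eqP->; case/orP=> /eqP->;
    by rewrite ?eqxx //= ?(negbTE nf0) ?[b == a]eq_sym ?(negbTE nf0) ?eqxx.
have c'E g : c' g = if connect (ab_rel c a b) f0 g then d g else c g.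
  by rewrite ffunE; case: ifP => // /on[_ ->].
(* An edge that touches the chain without lying on it has colour [w], so the switch creates no
   conflict there. *)
have cl f g : adj_edges f g -> connect (ab_rel c a b) f0 f ->
    ~~ connect (ab_rel c a b) f0 g -> c g = w.
  move=> fg cf ncg; apply/eqP; apply: contraR ncg => cg.
  apply: (connect_trans cf (connect1 _)); rewrite /ab_rel fg !inab cg.
  by have := (on _ cf).1; rewrite inab => ->.
have pc' : proper3 c'.
  apply/forallP => f; apply/forallP => g; apply/implyP => fg.
  rewrite !c'E; have [n1 n2] := P _ _ fg.
  case: ifP => cf; case: ifP => cg //.
    rewrite (cl _ _ fg cf (negbT cg)) -cd; have := (on _ cf).1.
    by rewrite inab.
  rewrite adjC in fg; rewrite (cl _ _ fg cg (negbT cf)) eq_sym -cd.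
  by have := (on _ cg).1; rewrite inab.
have c'd f : (c' f == w) = (d f == w) by rewrite c'E; case: ifP.
apply: (@connect_trans _ _ c').
  apply: connect1; rewrite /kempe_step pc pc' /=; apply/orP; left.
  apply/existsP; exists a; apply/existsP; exists b; apply/existsP; exists f0.
  by rewrite nf0 !inE eqxx /=.
apply: IHN => //; apply: leq_trans leN; apply: proper_card.
rewrite properE; apply/andP; split.
  by apply/subsetP => f; rewrite !inE c'E; case: ifP => //; rewrite eqxx.
by apply/subsetPn; exists f0; rewrite !inE ?c'E ?connect0 ?eqxx.
Qed.

(** Colours sit on ordered pairs of vertices, and only values on edges matter; this spares the graph
    surgery below the type of edges as vertex sets. *)
Definition coloring (c : T -> T -> 'I_3) : Prop :=
  (forall x y, e x y -> c x y = c y x) /\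
  (forall x y z, e x y -> e x z -> y != z -> c x y != c x z).

(** The common class may carry different names [w] and [w'], so that renaming colours is an
    instance. *)
Definition share_class (c d : T -> T -> 'I_3) : Prop :=
  exists w w', forall x y, e x y -> (c x y == w) = (d x y == w').

Inductive linked (c : T -> T -> 'I_3) : (T -> T -> 'I_3) -> Prop :=
| linked_refl : linked c c
| linked_step d f : linked c d -> coloring f -> share_class d f -> linked c f.

Definition one_color_class : Prop :=
  (exists c, coloring c) /\
  (forall c d, coloring c -> coloring d -> linked c d).

Lemma share_class_sym c d : share_class c d -> share_class d c.
Proof. by case=> w [w' H]; exists w', w => x y /H->. Qed.

Lemma linked_trans c d f : linked c d -> linked d f -> linked c f.
Proof. by move=> cd; elim=> // g h _ cg ch; apply: linked_step. Qed.

Lemma linked_coloring c d : coloring c -> linked c d -> coloring d.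
Proof. by move=> pc; case. Qed.

Lemma linked_sym c d : coloring c -> linked c d -> linked d c.
Proof.
move=> pc; elim=> [|f g cf IH pg fg]; first exact: linked_refl.
apply: linked_trans IH; apply: (linked_step (linked_refl g)).
  exact: linked_coloring cf.
exact: share_class_sym.
Qed.

Lemma coloring_comp (p : 'I_3 -> 'I_3) c :
  injective p -> coloring c -> coloring (fun x y => p (c x y)).
Proof.
move=> pI [cs cp]; split=> [x y /cs->//|x y z xy xz yz].
by rewrite (inj_eq pI) cp.
Qed.

Lemma share_class_comp (p : 'I_3 -> 'I_3) c :
  injective p -> share_class c (fun x y => p (c x y)).
Proof. by move=> pI; exists ord0, (p ord0) => x y _; rewrite (inj_eq pI). Qed.

Hypotheses (e_sym : symmetric e) (e_irr : irreflexive e).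

Lemma edge_proof x y : e x y -> [set x; y] \in edges e.
Proof. by move=> xy; apply/imsetP; exists (x, y); rewrite ?inE. Qed.

Definition edge x y (xy : e x y) : edgeT := exist _ [set x; y] (edge_proof xy).

Lemma edgeP (f : edgeT) : exists x y (xy : e x y), f = edge xy.
Proof.
case: f => A HA; have /imsetP[[x y]] := HA; rewrite inE /= => xy AE.
by exists x, y, xy; apply: val_inj.
Qed.

Lemma edge_endP (f : edgeT) x : x \in val f -> exists y (xy : e x y), f = edge xy.
Proof.
have [a [b [ab ->]]] := edgeP f; rewrite !inE => /orP[]/eqP->; first by exists b, ab.
have ba : e b a by rewrite e_sym.
by exists a, ba; apply: val_inj; rewrite /= setUC.
Qed.

Lemma edge_inj x y y' (xy : e x y) (xy' : e x y') :
  (edge xy == edge xy') = (y == y').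
Proof.
apply/eqP/eqP => [/(congr1 val) /= E|yy].
  have : y \in [set x; y'] by rewrite -E !inE eqxx orbT.
  by rewrite !inE => /orP[]/eqP // yx; rewrite yx e_irr in xy.
by apply: val_inj; rewrite /= yy.
Qed.

(** [pick] returns either orientation of the edge; a colouring has the same value on both. The
    default [ord0] is never reached. *)
Definition edge_coloring (c : T -> T -> 'I_3) : {ffun edgeT -> 'I_3} :=
  [ffun f => if [pick p : T * T | e p.1 p.2 && (val f == [set p.1; p.2])] is Some p
             then c p.1 p.2 else ord0].

Lemma edge_coloringE c x y (xy : e x y) :
  coloring c -> edge_coloring c (edge xy) = c x y.
Proof.
move=> [cs _]; rewrite ffunE; case: pickP => [[a b] /= /andP[ab /eqP E]|/(_ (x, y))];
  last by rewrite /= xy eqxx.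
have : a \in [set x; y] by rewrite E !inE eqxx.
have : b \in [set x; y] by rewrite E !inE eqxx orbT.
rewrite !inE => /orP[]/eqP bE /orP[]/eqP aE; move: ab; rewrite aE bE ?e_irr //.
by rewrite -cs.
Qed.

Lemma proper3_edge_coloring c : coloring c -> proper3 (edge_coloring c).
Proof.
move=> pc; apply/forallP => f; apply/forallP => g; apply/implyP => /andP[fg].
case/set0Pn => x; rewrite inE => /andP[/edge_endP[y [xy fE]] /edge_endP[z [xz gE]]].
move: fg; rewrite fE gE edge_inj !edge_coloringE //; exact: pc.2.
Qed.

Lemma edge_coloring_surj (d : {ffun edgeT -> 'I_3}) :
  proper3 d -> exists2 c, coloring c & d = edge_coloring c.
Proof.
move=> pd; pose c x y := if insub [set x; y] is Some f then d f else ord0.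
have cE x y (xy : e x y) : c x y = d (edge xy).
  rewrite /c; case: insubP => [f _ fE|]; last by rewrite edge_proof.
  by congr (d _); apply: val_inj.
have pc : coloring c.
  split=> [x y xy|x y z xy xz yz]; first by rewrite /c setUC.
  rewrite !cE; move/forallP: pd => /(_ (edge xy)) /forallP /(_ (edge xz)).
  move/implyP; apply; rewrite /adj_edges edge_inj yz /=.
  by apply/set0Pn; exists x; rewrite !inE eqxx.
exists c => //; apply/ffunP => f; have [x [y [xy ->]]] := edgeP f.
by rewrite edge_coloringE // cE.
Qed.

(** The transposition of [w] and [w'] fixes some colour [u], so it preserves the class of [u]; after
    it the common class is called [w'] in both colourings. Each of the two moves keeps a class
    together with its name. *)
Lemma kempe_equiv_share c d : coloring c -> coloring d -> share_class c d ->
  kempe_equiv (edge_coloring c) (edge_coloring d).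
Proof.
move=> pc pd [w [w' H]].
have same (c1 c2 : T -> T -> 'I_3) u : coloring c1 -> coloring c2 ->
    (forall x y, e x y -> (c1 x y == u) = (c2 x y == u)) ->
    kempe_equiv (edge_coloring c1) (edge_coloring c2).
  move=> p1 p2 E; apply: (@kempe_equiv_same_class _ _ u);
    try exact: proper3_edge_coloring.
  by move=> f; have [x [y [xy ->]]] := edgeP f; rewrite !edge_coloringE ?E.
have [u /andP[uw uw']] : exists u : 'I_3, (u != w) && (u != w').
  move: w w' {H}; case; case => [|[|[|//]]] ?; case; case => [|[|[|//]]] ?;
  by [exists (@Ordinal 3 0 isT)|exists (@Ordinal 3 1 isT)|exists (@Ordinal 3 2 isT)].
pose t := tperm w w'.
have pt := coloring_comp (@perm_inj _ t) pc.
apply: (@kempe_equiv_trans (edge_coloring (fun x y => t (c x y)))).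
  apply: (same _ _ u) => // x y _.
  by rewrite -{2}(tpermD _ _ : t u = u) ?(inj_eq perm_inj) // eq_sym.
apply: (same _ _ w') => // x y xy.
by rewrite -H // -{1}(tpermL w w') (inj_eq perm_inj).
Qed.

Lemma Kprime3_1 : one_color_class -> Kprime3 e = 1.
Proof.
case=> [[c0 pc0] lk]; rewrite /Kprime3.
have keq c d : coloring c -> linked c d ->
    kempe_equiv (edge_coloring c) (edge_coloring d).
  move=> pc; elim=> [|f g cf IH pg fg]; first exact: connect0.
  apply: (kempe_equiv_trans IH); apply: kempe_equiv_share => //.
  exact: linked_coloring cf.
apply/eqP/cards1P; exists [set d | @proper3 T e d].
apply/setP => S; rewrite inE; apply/imsetP/eqP => [[c pc ->]|->].
  apply/setP => d; rewrite !inE; case pd: (proper3 d) => //=.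
  have [c' pc' ->] := edge_coloring_surj pc; have [d' pd' ->] := edge_coloring_surj pd.
  by apply: keq => //; apply: lk.
exists (edge_coloring c0); first by rewrite inE proper3_edge_coloring.
apply/setP => d; rewrite !inE; case pd: (proper3 d) => //=.
have [d' pd' ->] := edge_coloring_surj pd.
by apply/esym/keq => //; apply: lk.
Qed.

End KempeClasses.

(** * A MacLane-type criterion for nonplanarity *)

(* [b] selects a subset of the edge list [H]. *)
Definition odd_at (H : seq (nat * nat)) (b : seq bool) (i : nat) : bool :=
  foldr (fun q s => (q.2 && ((i == q.1.1) (+) (i == q.1.2))) (+) s) false (zip H b).

Definition toggle (i : nat) (s : seq nat) : seq nat :=
  if i \in s then [seq j <- s | j != i] else i :: s.

Lemma mem_toggle i s j : (j \in toggle i s) = (j \in s) (+) (j == i).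
Proof.
rewrite /toggle; case: ifP => iS; rewrite ?mem_filter ?inE.
  by case: eqVneq => [->|_] /=; rewrite ?iS ?addbF.
by case: eqVneq => [->|_] /=; rewrite ?iS ?addbF.
Qed.

(* The subsets of [H] whose set of odd vertices is [odd]; a branch is pruned as
   soon as some odd vertex has no edge left. *)
Fixpoint parity_sets (odd : seq nat) (H : seq (nat * nat)) : seq (seq bool) :=
  if all (fun i => has (fun p => (i == p.1) || (i == p.2)) H) odd then
    if H is p :: H' then
      map (cons false) (parity_sets odd H') ++
      map (cons true) (parity_sets (toggle p.2 (toggle p.1 odd)) H')
    else [:: [::]]
  else [::].

Lemma odd_at_untouched H b i :
  ~~ has (fun p => (i == p.1) || (i == p.2)) H -> odd_at H b i = false.
Proof.
rewrite /odd_at; elim: H b => [|p H IH] [|x b] //=.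
by rewrite !negb_or => /andP[/andP[/negbTE-> /negbTE->] /IH->]; rewrite andbF.
Qed.

Lemma mem_parity_sets odd H b :
  b \in parity_sets odd H <-> size b = size H /\ forall i, odd_at H b i = (i \in odd).
Proof.
elim: H odd b => [|p H IH] odd b /=.
  case: odd => [|i odd] /=; rewrite ?inE; split=> //.
  - by move=> /eqP->; split.
  - by case: b => [|x b] [] //=.
  - by case=> _ /(_ i); rewrite inE eqxx /odd_at; case: b.
case: ifP => [_|/negbT/allPn[i iodd ni]]; last first.
  split=> // -[_ /(_ i)]; rewrite iodd odd_at_untouched //.
case: b => [|x b].
  by split=> [|[]//]; rewrite mem_cat => /orP[]/mapP[].
have -> : (x :: b \in [seq false :: i | i <- parity_sets odd H] ++
    [seq true :: i | i <- parity_sets (toggle p.2 (toggle p.1 odd)) H]) =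
    (b \in parity_sets (if x then toggle p.2 (toggle p.1 odd) else odd) H).
  rewrite mem_cat; case: x; last first.
    by rewrite mem_map => [|? ? []//]; rewrite orbC; case: mapP => [[]|].
  by rewrite [X in _ || X]mem_map => [|? ? []//]; case: mapP => [[]|].
rewrite IH; split=> -[sb K]; split; [by rewrite /= sb| |by case: sb|].
  move=> i; rewrite /odd_at /= -/(odd_at H b i) K; case: (x) => //=.
  by rewrite !mem_toggle; do 3 case: (_ \in _) || case: (_ == _).
move=> i; move: (K i); rewrite /odd_at /= -/(odd_at H b i); case: (x) => //= E.
by rewrite !mem_toggle -E; case: (odd_at _ _ _); do 2 case: (_ == _).
Qed.

Lemma uniq_parity_sets odd H : uniq (parity_sets odd H).
Proof.
elim: H odd => [|p H IH] odd /=; case: ifP => // _.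
rewrite cat_uniq !map_inj_uniq ?IH ?andbT; try by move=> ? ? [].
by apply/hasPn => _ /mapP[b _ ->]; apply/negP => /mapP[].
Qed.

(* Satisfied by a subdivision of K_{3,3} on the vertices [0..k-1] whose edge
   list starts with one edge from each of the nine branches: the cycle space
   has more than 8 elements and every cycle uses at least four branches. *)
Definition k33_certificate k (H : seq (nat * nat)) : bool :=
  [&& all (fun p => (p.1 < k) && (p.2 < k)) H,
      uniq (H ++ [seq (p.2, p.1) | p <- H]),
      8 < size (parity_sets [::] H) &
      all (fun b => has id b ==> (4 <= count id (take 9 b))) (parity_sets [::] H)].

(** * Exactness by counting dimensions *)

Section ConstantKernel.
Import GRing.Theory.
Variable K : fieldType.
Local Open Scope ring_scope.

(** The left kernel, of dimension [m] minus the rank, lies in the line spanned by the constant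
    vector. *)
Lemma rank_const_ker m p (A : 'M[K]_(m, p)) :
  (forall u : 'rV_m, u *m A = 0 -> exists c, u = const_mx c) ->
  (m <= \rank A + 1)%N.
Proof.
move=> H; rewrite -leq_subLR -mxrank_ker.
apply: leq_trans (rank_leq_row (const_mx 1 : 'rV[K]_m)).
apply/mxrankS/rV_subP => u /sub_kermxP /H[c ->].
by apply/submxP; exists c%:M; rewrite mul_scalar_mx; apply/matrixP => i j; rewrite !mxE mulr1.
Qed.

(** The image of [A] lies in the kernel of [B], whose dimension is at most [p - q + 1], hence at
    most [m - 1], while the rank of [A] is at least [m - 1]. *)
Lemma exact_const_ker m p q (A : 'M[K]_(m, p)) (B : 'M[K]_(p, q)) :
  A *m B = 0 ->
  (forall u : 'rV_m, u *m A = 0 -> exists c, u = const_mx c) ->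
  (forall u : 'rV_q, u *m B^T = 0 -> exists c, u = const_mx c) ->
  (p + 2 <= m + q)%N ->
  forall z : 'rV_p, z *m B = 0 -> exists u, z = u *m A.
Proof.
move=> AB /rank_const_ker rA /rank_const_ker; rewrite mxrank_tr => rB pmq z zB.
apply/submxP.
have sA : (A <= kermx B)%MS by apply/sub_kermxP.
apply: (@submx_trans _ _ _ _ _ _ (kermx B)); first exact/sub_kermxP.
rewrite -(geq_leqif (mxrank_leqif_sup sA)) mxrank_ker.
by rewrite leq_subLR; lia.
Qed.

End ConstantKernel.

(** * The chain complex of a rotation system over the field with two elements *)

Section FaceSpace.
Import GRing.Theory.
Variables (T : finType) (e : rel T).
Local Notation dart := {p : T * T | e p.1 p.2 && e p.2 p.1}.
Local Open Scope ring_scope.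

Definition cut_connected : Prop :=
  forall f : T -> bool, (forall x y, e x y -> f x = f y) -> forall x y, f x = f y.

Hypotheses (e_sym : symmetric e) (e_irr : irreflexive e).
Hypothesis e_conn : cut_connected.
Hypothesis e_deg : forall x, exists y, e x y.
Variable side : T -> bool.
Hypothesis sideP : forall x y, e x y -> side x != side y.
Variable sigma : {perm dart}.
Hypothesis sigma_tl : forall d, (val (sigma d)).1 = (val d).1.
Hypothesis sigma_tr : forall d d' : dart, (val d).1 = (val d').1 -> d' \in porbit sigma d.
Hypothesis euler : (#|T| + (#|porbits (alpha e * sigma)| + #|isolated e|)
          = #|edges e| + 2 * n_comp [rel x y | e x y || e y x] T)%N.

Local Notation tl d := (val d).1.
Local Notation hd d := (val d).2.
Local Notation rev := (@rev_dart T e).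
Local Notation fp := (alpha e * sigma)%g.

Let revK : involutive rev. Proof. exact: rev_dartK. Qed.
Let fpE d : fp d = sigma (rev d). Proof. by rewrite permM permE. Qed.
Let tl_fp d : tl (fp d) = hd d. Proof. by rewrite fpE sigma_tl. Qed.
Let dart_e (d : dart) : e (tl d) (hd d). Proof. by case: d => p /= /andP[]. Qed.
Let dartP x y : e x y -> exists d : dart, val d = (x, y).
Proof. by move=> xy; have h : e x y && e y x; [rewrite xy e_sym xy | exists (exist _ (x, y) h)]. Qed.

(** Here [bool] is the field with two elements. Since [fp] carries the darts with head [x] onto
    those with tail [x], both halves of the sum agree and cancel. *)
Lemma face_boundary_even (g : dart -> bool) x : (forall d, g (fp d) = g d) ->
  \sum_(d | tl d == x) (g d + g (rev d)) = 0.
Proof.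
move=> gf; rewrite big_split /=.
have -> : \sum_(d | tl d == x) g (rev d) = \sum_(d | tl d == x) g d; last exact: addbb.
rewrite (reindex_inj (inv_inj revK)) /=.
rewrite [RHS](reindex_inj (@perm_inj _ fp)) /=.
by apply: eq_big => d; rewrite ?tl_fp // revK gf.
Qed.

(** [sigma] is [rev] followed by [fp], and it is transitive on the darts at a vertex. *)
Lemma vertex_const (g : dart -> bool) d d' :
  (forall d, g (fp d) = g d) -> (forall d, g (rev d) = g d) -> tl d = tl d' -> g d = g d'.
Proof.
move=> gf gr /sigma_tr /porbitP[i ->].
elim: i => [|i IH]; first by rewrite expg0 perm1.
by rewrite expgSr permM -[(sigma ^+ i)%g d]revK -fpE gf gr.
Qed.

(** Being constant around each vertex, [g] descends to a function on vertices that is constant along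
    edges. *)
Lemma dart_const (g : dart -> bool) : (forall d, g (fp d) = g d) ->
  (forall d, g (rev d) = g d) -> forall d d', g d = g d'.
Proof.
move=> gf gr d d'.
pose f x := [exists d : dart, (tl d == x) && g d].
have fE d1 : f (tl d1) = g d1.
  apply/existsP/idP => [[d2 /andP[/eqP E]]|gd]; last by exists d1; rewrite eqxx.
  by rewrite (vertex_const gf gr E).
rewrite -!fE; apply: e_conn => x y xy.
have [d1 E] := dartP xy.
have -> : x = tl d1 by rewrite E.
have -> : y = tl (rev d1) by rewrite /= E.
by rewrite !fE gr.
Qed.

(** The bipartition orients every edge: [P] holds exactly one of its two darts and serves as the
    edge set of the complex. *)
Let P : {set dart} := [set d | side (tl d)].

Let revP d : (rev d \in P) = (d \notin P).
Proof. by rewrite !inE /=; have := sideP (dart_e d); do 2 case: (side _). Qed.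

Let half_sum (s : dart -> bool) : \sum_(d in P) (s d + s (rev d)) = \sum_d s d.
Proof.
rewrite big_split /= [RHS](bigID (mem P)) /=; congr (_ + _).
rewrite (reindex_inj (inv_inj revK)) /=.
by apply: eq_big => d; rewrite ?revK // revP.
Qed.

Let face_ix (d : dart) : 'I_#|porbits fp| :=
  enum_rank_in (imset_f (porbit fp) (isT : d \in {: dart})) (porbit fp d).

Let face (i : 'I_#|porbits fp|) : {set dart} := enum_val i.

Let face_ixE d i : (d \in face i) = (i == face_ix d).
Proof.
rewrite -(inj_eq enum_val_inj) /face /face_ix enum_rankK_in ?imset_f //.
have /imsetP[d' _ ->] := enum_valP i.
by rewrite [RHS]eq_sym eq_porbit_mem.
Qed.

Let face_ix_fp d : face_ix (fp d) = face_ix d.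
Proof.
apply/eqP; rewrite eq_sym -face_ixE /face /face_ix enum_rankK_in ?imset_f //.
by have := mem_porbit fp 1 d; rewrite expg1.
Qed.

Let sum_face (u : 'rV[bool]_#|porbits fp|) d :
  \sum_i u 0 i * (d \in face i) = u 0 (face_ix d).
Proof.
rewrite (bigD1 (face_ix d)) //= big1 ?addr0 => [|i /negbTE nd].
  by rewrite face_ixE eqxx mulr1.
by rewrite face_ixE nd mulr0.
Qed.

(** Boundary maps of the cellular chain complex modulo 2, acting on row vectors: [A] sends faces to
    edges, [B] edges to vertices. *)
Let A : 'M[bool]_(#|porbits fp|, #|P|) :=
  \matrix_(i, j) ((enum_val j \in face i) + (rev (enum_val j) \in face i)).
Let B : 'M[bool]_(#|P|, #|T|) :=
  \matrix_(j, x) ((tl (enum_val j) == enum_val x) + (hd (enum_val j) == enum_val x)).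

Let uA (u : 'rV[bool]_#|porbits fp|) j :
  (u *m A) 0 j = u 0 (face_ix (enum_val j)) + u 0 (face_ix (rev (enum_val j))).
Proof.
rewrite !mxE -!sum_face -big_split /=.
by apply: eq_bigr => i _; rewrite !mxE mulrDr.
Qed.

Let zB (z : dart -> bool) x : (forall d, z (rev d) = z d) ->
  \sum_(j < #|P|) z (enum_val j) * B j x = \sum_(d | tl d == enum_val x) z d.
Proof.
move=> zr; under eq_bigr => j _ do rewrite mxE.
rewrite -(big_enum_val (A := mem P) (fun d => z d * ((tl d == enum_val x) + (hd d == enum_val x)))) /=.
rewrite [RHS]big_mkcond /= -half_sum; apply: eq_bigr => d _.
by rewrite zr /=; do 2 case: (_ == _); case: (z d).
Qed.

Let AB : A *m B = 0.
Proof.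
apply/matrixP => i x; rewrite !mxE.
pose g d := d \in face i.
rewrite -[RHS](@face_boundary_even g (enum_val x)); last first.
  by move=> d; rewrite /g !face_ixE face_ix_fp.
rewrite -zB => [|d]; last by rewrite revK addrC.
by apply: eq_bigr => j _; rewrite !mxE.
Qed.

(** A kernel vector gives a function on darts invariant under both [fp] and [rev]. *)
Let constA (u : 'rV_#|porbits fp|) : u *m A = 0 -> exists c, u = const_mx c.
Proof.
move=> u0; pose g d := u 0 (face_ix d).
have gf d : g (fp d) = g d by rewrite /g face_ix_fp.
have gr d : g (rev d) = g d.
  wlog dP : d / d \in P.
    by move=> W; case dP: (d \in P); [exact: W|rewrite -(W (rev d)) ?revK // revP dP].
  have := uA u (enum_rank_in dP d); rewrite u0 mxE enum_rankK_in // -/(g d) -/(g (rev d)).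
  by do 2 case: (g _).
have gc := dart_const gf gr.
have fs i : exists d, i = face_ix d.
  have /imsetP[d _ E] := enum_valP i; exists d; apply/eqP.
  by rewrite -face_ixE /face E porbit_id.
case: (pickP [pred i : 'I_#|porbits fp| | true]) => [i0 _|no]; last first.
  by exists 0; apply/rowP => i; have := no i.
exists (u 0 i0); apply/rowP => i; rewrite mxE.
have [d ->] := fs i; have [d0 ->] := fs i0; exact: gc.
Qed.

(** A kernel vector of the transpose is a function on vertices that is constant along edges. *)
Let constB (u : 'rV_#|T|) : u *m B^T = 0 -> exists c, u = const_mx c.
Proof.
move=> u0; pose f x := u 0 (enum_rank x).
have fc : forall x y, f x = f y.
  apply: e_conn => x y xy.
  wlog sx : x y xy / side x.
    move=> W; have := sideP xy; case sx: (side x); first by move=> _; exact: W.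
    by move=> sy; apply/esym/W; [rewrite e_sym|move: sy; case: (side y)].
  have [d dE] := dartP xy; have dP : d \in P by rewrite inE dE.
  have /matrixP /(_ 0 (enum_rank_in dP d)) := u0; rewrite !mxE.
  under eq_bigr => i _ do rewrite !mxE enum_rankK_in // dE /=.
  rewrite (bigD1 (enum_rank x)) //= (bigD1 (enum_rank y)) /=; last first.
    by rewrite (inj_eq enum_rank_inj) eq_sym; apply: contraTneq xy => ->; rewrite e_irr.
  rewrite big1 => [|i /andP[/eqP ix /eqP iy]]; last first.
    have -> : (x == enum_val i) = false by apply/eqP => E; case: ix; rewrite E enum_valK.
    have -> : (y == enum_val i) = false by apply/eqP => E; case: iy; rewrite E enum_valK.
    by rewrite mulr0.
  rewrite !enum_rankK !eqxx.
  have -> : (y == x) = false by apply/eqP => E; move: xy; rewrite E e_irr.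
  have -> : (x == y) = false by apply/eqP => E; move: xy; rewrite E e_irr.
  by rewrite -!/(f _); do 2 case: (f _).
case: (pickP T) => [x0 _|no].
  by exists (f x0); apply/rowP => i; rewrite mxE -(fc (enum_val i)) /f enum_valK.
by exists 0; apply/rowP => i; have := no (enum_val i).
Qed.

(** Euler's formula with no isolated vertex and at least one component; the darts in [P] inject into
    the edges. *)
Let dim_bound : T -> (#|P| + 2 <= #|porbits fp| + #|T|)%N.
Proof.
move=> x0.
have iso0 : #|isolated e| = 0%N.
  apply: eq_card0 => x; rewrite inE; apply/negbTE/negP => /forallP H.
  by have [y xy] := e_deg x; have := H y; rewrite xy.
have comp1 : (0 < n_comp [rel x y | e x y || e y x] T)%N.
  apply/card_gt0P; exists (fingraph.root [rel x y | e x y || e y x] x0).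
  rewrite inE /= andbT; apply: roots_root.
  by apply: sym_connect_sym => x y /=; rewrite orbC.
have PE : (#|P| <= #|edges e|)%N.
  rewrite -(card_in_imset (f := fun d : dart => [set tl d; hd d])) ?subset_leq_card //.
    apply/subsetP => S /imsetP[d _ ->]; apply/imsetP; exists (val d) => //.
    by rewrite inE; apply: dart_e.
  move=> d d'; rewrite !inE => sd sd' E; apply: val_inj.
  have shd (c : dart) : side (tl c) -> side (hd c) = false.
    by have := sideP (dart_e c); do 2 case: (side _).
  have h1 : tl d \in [set tl d'; hd d'] by rewrite -E !inE eqxx.
  have h2 : hd d \in [set tl d'; hd d'] by rewrite -E !inE eqxx orbT.
  have E1 : tl d = tl d'.
    by move: h1; rewrite !inE => /orP[]/eqP // E1; rewrite E1 shd in sd.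
  have E2 : hd d = hd d'.
    by move: h2; rewrite !inE => /orP[]/eqP // E2; rewrite -E2 shd in sd'.
  by rewrite (surjective_pairing (val d)) E1 E2 -surjective_pairing.
by move: euler; rewrite iso0; lia.
Qed.

(* By Euler's formula the ranks leave no room for homology. *)
Lemma even_is_face_boundary (z : dart -> bool) : (forall d, z (rev d) = z d) ->
  (forall x, \sum_(d | tl d == x) z d = 0) ->
  exists2 g : dart -> bool, (forall d, g (fp d) = g d) &
    forall d, z d = g d + g (rev d).
Proof.
move=> zr ze.
case: (pickP T) => [x0 _|no]; last by exists z => d; have := no (tl d).
have [|u zu] := exact_const_ker AB constA constB (dim_bound x0)
  (z := \row_j z (enum_val j)).
  apply/rowP => x; rewrite !mxE.
  under eq_bigr => j _ do rewrite mxE.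
  by rewrite zB.
exists (fun d => u 0 (face_ix d)) => [d|d]; first by rewrite face_ix_fp.
wlog dP : d / d \in P.
  move=> W; case dP: (d \in P); first exact: W.
  by rewrite -zr W ?revP ?dP // revK addrC.
have /rowP /(_ (enum_rank_in dP d)) := zu.
by rewrite mxE uA enum_rankK_in.
Qed.

(** * Regions of a subdivision of K_{3,3} *)

Section Subdivision.
Variables (k : nat) (H : seq (nat * nat)) (f : nat -> T).
Hypothesis f_inj : {in gtn k &, injective f}.
Hypothesis f_edge : forall p, p \in H -> e (f p.1) (f p.2).
Hypothesis H_k33 : k33_certificate k H.

Let m := size H.
Let H_ (j : 'I_m) := nth (0, 0)%N H j.

Let H_in j : H_ j \in H. Proof. exact: mem_nth. Qed.

Let H_lt j : ((H_ j).1 < k)%N && ((H_ j).2 < k)%N.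
Proof. by case/and4P: H_k33 => /allP /(_ _ (H_in j)). Qed.

Let hit j (d : dart) :=
  (val d == (f (H_ j).1, f (H_ j).2)) || (val d == (f (H_ j).2, f (H_ j).1)).

Let dart_of j : {d : dart | val d = (f (H_ j).1, f (H_ j).2)}.
Proof.
have h := f_edge (H_in j).
have h' : e (f (H_ j).1) (f (H_ j).2) && e (f (H_ j).2) (f (H_ j).1).
  by rewrite h e_sym h.
by exists (exist _ (f (H_ j).1, f (H_ j).2) h').
Qed.

Let hitE j d : hit j d = (d == sval (dart_of j)) || (d == rev (sval (dart_of j))).
Proof.
rewrite /hit; case: (dart_of j) => d' E.
by rewrite -!(inj_eq val_inj) /= E.
Qed.

Let hit_rev j d : hit j (rev d) = hit j d.
Proof. by rewrite !hitE (can2_eq revK revK) (inj_eq (inv_inj revK)) orbC. Qed.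

Let hit_inj j j' d : hit j d -> hit j' d -> j = j'.
Proof.
have [Hu _] : uniq (H ++ [seq (p.2, p.1) | p <- H]) /\ True by case/and4P: H_k33.
move: Hu; rewrite cat_uniq => /and3P[Hu /hasPn Hn _].
have E a b : H_ a = H_ b -> a = b.
  by move/eqP; rewrite nth_uniq // => /eqP /val_inj.
have N a b : H_ a = ((H_ b).2, (H_ b).1) -> False.
  move=> ab; have := Hn _ (map_f (fun p => (p.2, p.1)) (H_in b)).
  by rewrite /= -ab H_in.
have [/andP[a1 a2] /andP[b1 b2]] := (H_lt j, H_lt j').
rewrite /hit => /orP[]/eqP-> /orP[]/eqP[] E1 E2.
- by apply: E; rewrite [LHS]surjective_pairing (f_inj a1 b1 E1) (f_inj a2 b2 E2) -surjective_pairing.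
- by case: (N j j'); rewrite [LHS]surjective_pairing (f_inj a1 b2 E1) (f_inj a2 b1 E2).
- by case: (N j j'); rewrite [LHS]surjective_pairing (f_inj a1 b2 E2) (f_inj a2 b1 E1).
- by apply: E; rewrite [LHS]surjective_pairing (f_inj a1 b1 E2) (f_inj a2 b2 E1) -surjective_pairing.
Qed.

Let sum_hit j x :
  \sum_(d | tl d == x) hit j d = (x == f (H_ j).1) + (x == f (H_ j).2) :> bool.
Proof.
have S (Q : pred dart) a : \sum_(d | Q d) (d == a) = Q a :> bool.
  case Qa: (Q a); last first.
    by rewrite big1 // => d Qd; apply/negbTE/eqP => E; rewrite E Qa in Qd.
  rewrite (bigD1 a Qa) eqxx big1; first exact: addr0.
  by move=> d /andP[_ da]; apply/negbTE.
transitivity (\sum_(d | tl d == x) ((d == sval (dart_of j)) + (d == rev (sval (dart_of j))))).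
  apply: eq_bigr => d _; rewrite hitE; case: eqP => [->|//].
  case: eqP => // /(congr1 (fun d => tl d)) /= E.
  by have := dart_e (sval (dart_of j)); rewrite E e_irr.
rewrite big_split /= !S; case: (dart_of j) => d' /= E.
by rewrite E /= ![x == _]eq_sym.
Qed.

(** [zof] and [bits] translate between bit lists over [H] and functions on darts that are invariant
    under [rev] and supported on the subdivision. *)
Let zof (b : seq bool) d := \sum_(j < m) nth false b j * hit j d.

Let zof_hit b j d : hit j d -> zof b d = nth false b j.
Proof.
move=> hj; rewrite /zof (bigD1 j) //= hj mulr1 big1 ?addr0 // => i ij.
case hi: (hit i d); last exact: mulr0.
by rewrite (hit_inj hi hj) eqxx in ij.
Qed.

Let bit (z : dart -> bool) (p : nat * nat) :=
  [exists d : dart, (val d == (f p.1, f p.2)) && z d].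
Let bits z := [seq bit z p | p <- H].

Let bitE z j : bit z (H_ j) = z (sval (dart_of j)).
Proof.
case: (dart_of j) => d' E; rewrite [sval _]/=; apply/existsP/idP => [[d /andP[/eqP dE]]|zd].
  by have -> : d = d' by apply: val_inj; rewrite dE.
by exists d'; rewrite E eqxx.
Qed.

Let nth_bits z (j : 'I_m) : nth false (bits z) j = z (sval (dart_of j)).
Proof. by rewrite (nth_map (0, 0)%N) // bitE. Qed.

Let bits_zof b : size b = m -> bits (zof b) = b.
Proof.
move=> sb; apply: (@eq_from_nth _ false) => [|i]; rewrite size_map // => im.
rewrite (nth_bits _ (Ordinal im)) (@zof_hit _ (Ordinal im)) //.
by rewrite hitE eqxx.
Qed.

Let zof_rev b d : zof b (rev d) = zof b d.
Proof. by apply: eq_bigr => j _; rewrite hit_rev. Qed.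

Let odd_at_sum b i : size b = m -> odd_at H b i =
  \sum_(j < m) nth false b j * ((i == (H_ j).1) + (i == (H_ j).2)) :> bool.
Proof.
move=> sb.
have -> : odd_at H b i =
    \sum_(q <- zip H b) q.2 * ((i == q.1.1) + (i == q.1.2)) :> bool.
  by rewrite unlock /odd_at; elim: (zip H b) => //= q s ->.
rewrite (big_nth ((0, 0), false)%N) size_zip sb minnn big_mkord.
by apply: eq_bigr => j _; rewrite nth_zip.
Qed.

Let odd_atE b i : size b = m -> (i < k)%N ->
  odd_at H b i = \sum_(d | tl d == f i) zof b d :> bool.
Proof.
move=> sb ik; rewrite exchange_big odd_at_sum //=; apply: eq_bigr => j _.
rewrite -big_distrr /= sum_hit; have /andP[j1 j2] := H_lt j.
by rewrite !(inj_in_eq f_inj).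
Qed.

Let zof_even b x : b \in parity_sets [::] H -> \sum_(d | tl d == x) zof b d = 0.
Proof.
move/mem_parity_sets => [sb bev].
have [i /eqP ->|no] := pickP [pred i : 'I_k | x == f i].
  by rewrite -odd_atE // bev.
rewrite exchange_big big1 // => j _; rewrite -big_distrr /= sum_hit.
have /andP[j1 j2] := H_lt j.
have := no (Ordinal j1); have := no (Ordinal j2) => /= -> ->.
by rewrite addr0 mulr0.
Qed.

Let inH d := [exists j, hit j d].

Let zof_bits (z : dart -> bool) d : (forall d, z (rev d) = z d) -> (forall d, z d -> inH d) ->
  zof (bits z) d = z d.
Proof.
move=> zr zs; case dH: (inH d); last first.
  have -> : z d = false by apply/negP => /zs; rewrite dH.
  rewrite /zof big1 // => j _; case hj: (hit j d); last exact: mulr0.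
  by case/existsP: dH; exists j.
have /existsP[j hj] := dH; rewrite (zof_hit _ hj) nth_bits.
by move: hj; rewrite hitE => /orP[]/eqP-> //; rewrite zr.
Qed.

Let bits_even (z : dart -> bool) : (forall d, z (rev d) = z d) -> (forall d, z d -> inH d) ->
  (forall x, \sum_(d | tl d == x) z d = 0) -> bits z \in parity_sets [::] H.
Proof.
move=> zr zs ze; have sb : size (bits z) = m by rewrite size_map.
apply/mem_parity_sets; split=> // i; case: (ltnP i k) => ik.
  rewrite odd_atE //; under eq_bigr => d _ do rewrite zof_bits //.
  exact: ze.
rewrite odd_at_sum // big1 // => j _; have /andP[j1 j2] := H_lt j.
have -> : (i == (H_ j).1) = false by apply/negbTE/eqP; lia.
have -> : (i == (H_ j).2) = false by apply/negbTE/eqP; lia.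
exact: mulr0.
Qed.

(** Regions are the classes generated by walking along a face and by crossing an edge outside the
    subdivision; [reg] picks a representative dart. *)
Let R := [rel d d' : dart | (d' == fp d) || ((d' == rev d) && ~~ inH d)].
Let Rs := [rel d d' | R d d' || R d' d].
Let reg := fingraph.root Rs.

Let Rs_sym : connect_sym Rs.
Proof. by apply: sym_connect_sym => d d' /=; rewrite orbC. Qed.

Let reg_fp d : reg (fp d) = reg d.
Proof.
apply/esym/eqP; rewrite root_connect //; apply: connect1.
by rewrite /= eqxx.
Qed.

Let reg_rev d : ~~ inH d -> reg (rev d) = reg d.
Proof.
move=> dH; apply/esym/eqP; rewrite root_connect //; apply: connect1.
by rewrite /= eqxx dH orbT.
Qed.

Let reg_const (g : dart -> bool) d : (forall d, g (fp d) = g d) ->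
  (forall d, ~~ inH d -> g (rev d) = g d) -> g (reg d) = g d.
Proof.
move=> gf gr; have /connectP[p] := connect_root Rs d.
rewrite -/(reg d) => pp ->; elim: p d pp => //= d' p IH d /andP[dd' /IH ->].
by case/orP: dd' => /orP[/eqP->|/andP[/eqP-> /gr]] //.
Qed.

(** [S] is the set of regions, and [zX X] the boundary modulo 2 of the union of the regions in
    [X]. *)
Let S := [set reg d | d : dart].
Let zX (X : {set dart}) d := (reg d \in X) + (reg (rev d) \in X).

Let zX_rev X d : zX X (rev d) = zX X d.
Proof. by rewrite /zX revK addrC. Qed.

Let zX_inH X d : zX X d -> inH d.
Proof. by apply: contraTT => dH; rewrite /zX reg_rev //; case: (_ \in _). Qed.

Let zX_even X : bits (zX X) \in parity_sets [::] H.
Proof.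
apply: bits_even => [d|d|x]; [exact: zX_rev|exact: zX_inH|].
apply: (face_boundary_even (g := fun d => reg d \in X)) => d.
by rewrite reg_fp.
Qed.

(** Each even subset of [H] is the boundary of a set of regions omitting that of [d0]; more than
    [2 ^ 3] such subsets need more than three other regions. *)
Let card_regions : (4 < #|S|)%N.
Proof.
have [y0 xy0] := e_deg (f 0%N); have [d0 _] := dartP xy0.
have rS d : reg d \in S by apply: imset_f.
have lt8 : (8 < size (parity_sets [::] H))%N by case/and4P: H_k33.
rewrite (cardsD1 (reg d0)) rS add1n ltnS -(ltn_exp2l 3%N _ (isT : 1 < 2)%N).
apply: leq_trans lt8 _; rewrite -card_powerset cardE.
rewrite -(size_map (fun X => bits (zX X))); apply: uniq_leq_size.
  exact: uniq_parity_sets.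
move=> b bev.
have [g gf gE] := even_is_face_boundary (zof_rev b) (fun x => zof_even x bev).
have gr d : ~~ inH d -> g (rev d) = g d.
  move=> dH; have : zof b d = 0.
    rewrite /zof big1 // => j _; case hj: (hit j d); last exact: mulr0.
    by case/existsP: dH; exists j.
  by rewrite gE; do 2 case: (g _).
(* Adding the constant [g d0] leaves the boundary unchanged and excludes the region of [d0]. *)
apply/mapP; exists [set s in S | g s + g d0].
  rewrite mem_enum powersetE; apply/subsetP => s; rewrite !inE => /andP[-> gs].
  rewrite andbT; apply: contraTneq gs => ->.
  by rewrite reg_const //; case: (g d0).
rewrite -[LHS]bits_zof; last by case/mem_parity_sets: bev.
apply: eq_map => p; apply: eq_existsb => d; congr (_ && _).
by rewrite gE /zX !inE !rS !reg_const //=; do 3 case: (g _).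
Qed.

(** The boundary of a region is an even set, so the certificate applies once it is nonempty; were it
    empty, the region would be the only one, against [card_regions]. *)
Let region_reps s : s \in S -> (4 <= count (bit (zX [set s])) (take 9 H))%N.
Proof.
move=> sS; have := zX_even [set s]; case/and4P: H_k33 => _ _ _ /allP K /K.
rewrite /bits -map_take count_map => /implyP; apply.
apply/negPn/negP => no; have z0 d : zX [set s] d = 0.
  rewrite -zof_bits; [|exact: zX_rev|exact: zX_inH].
  rewrite /zof big1 // => j _; rewrite -[nth _ _ _]negbK.
  case E : (nth false _ j); last by rewrite /= mul0r.
  case/hasP: no; exists true => //; rewrite -E; apply: mem_nth.
  by rewrite size_map.
have gc := @dart_const (fun d => reg d \in [set s]).
have : (#|S| <= 1)%N.
  rewrite -(cards1 s) subset_leq_card //; apply/subsetP => _ /imsetP[d _ ->].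
  case/imsetP: sS => d1 _ sE; rewrite (gc _ _ d d1) ?sE ?inE // => d'.
    by rewrite reg_fp.
  by have := z0 d'; rewrite /zX sE; do 2 case: (_ \in _).
by have := card_regions; lia.
Qed.

Lemma k33_subdivision_contradiction : False.
Proof.
have le9 : (\sum_(p <- take 9 H) \sum_(s in S) bit (zX [set s]) p <= \sum_(p <- take 9 H) 2)%N.
  rewrite big_seq [leqRHS]big_seq; apply: leq_sum => p /mem_take pH.
  have [j <-] : exists j, H_ j = p.
    have jm : (index p H < m)%N by rewrite index_mem.
    by exists (Ordinal jm); rewrite /H_ nth_index.
  (* A branch representative has two darts, each in a single region. *)
  have one d : (\sum_(s in S) (reg d == s) <= 1)%N.
    rewrite big_mkcond (bigD1 (reg d)) //= big1 ?addn0.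
      by case: ifP => // _; rewrite eqxx.
    by move=> i /negbTE; rewrite eq_sym => ->; case: ifP.
  set d := sval (dart_of j).
  apply: leq_trans (leq_add (one d) (one (rev d))).
  rewrite -big_split /=; apply: leq_sum => s _.
  by rewrite bitE /zX !inE -/d; do 2 case: (_ == s).
have : (\sum_(s in S) 4 <= 18)%N.
  apply: (@leq_trans (\sum_(p <- take 9 H) 2)%N); last first.
    by rewrite big_const_seq count_predT iter_addn_0 size_take; case: ifP => /=; lia.
  apply: leq_trans le9; rewrite exchange_big /=; apply: leq_sum => s /region_reps.
  by rewrite -sum1_count big_mkcond /= => /leq_trans; apply; apply: leq_sum => p _; case: (bit _ _).
rewrite sum_nat_const; have := card_regions; lia.
Qed.

End Subdivision.
End FaceSpace.

(** * Replacing a vertex by a cube minus a vertex *)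

(** Two-valued functions again express connectedness; [r1 = r2] deletes a single vertex. *)
Definition three_connected (T : finType) (e : rel T) : Prop :=
  forall (r1 r2 : T) (f : T -> bool),
    (forall x y, e x y -> x \notin [:: r1; r2] -> y \notin [:: r1; r2] -> f x = f y) ->
    forall x y, x \notin [:: r1; r2] -> y \notin [:: r1; r2] -> f x = f y.

Definition three_neighbours (T : finType) (e : rel T) : Prop :=
  forall x, exists s : seq T, [/\ uniq s, size s = 3 & forall y, e x y = (y \in s)].

Definition k33_avoiding (T : finType) (e : rel T) (v : T) : Prop :=
  exists k H (f : nat -> T), [/\ k33_certificate k H, {in gtn k &, injective f},
    forall p, p \in H -> e (f p.1) (f p.2) & forall i, i < k -> f i != v].

(** The invariant of the construction. The marked vertex [v] is the next to be replaced; afterwards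
    [inl v] takes over this role, so the replacement can be iterated. *)
Record admissible (T : finType) (e : rel T) (v : T) : Prop := Admissible {
  adm_sym : symmetric e;
  adm_irr : irreflexive e;
  adm_bip : bipartite e;
  adm_cubic : three_neighbours e;
  adm_conn : three_connected e;
  adm_color : one_color_class e;
  adm_k33 : k33_avoiding e v }.

Lemma ord3_ind (P : 'I_3 -> Prop) :
  P (@Ordinal 3 0 isT) -> P (@Ordinal 3 1 isT) -> P (@Ordinal 3 2 isT) -> forall i, P i.
Proof.
by move=> P0 P1 P2 [[|[|[|//]]] i]; rewrite (bool_irrelevance i isT).
Qed.

(** Otherwise the disjoint lists would contain three distinct entries among [r1] and [r2]. *)
Lemma disjoint_path_avoiding (A : eqType) (r1 r2 : A) (p1 p2 p3 : seq A) :
  uniq (p1 ++ p2 ++ p3) ->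
  exists2 p, p \in [:: p1; p2; p3] & all (fun a => a \notin [:: r1; r2]) p.
Proof.
move=> U; apply/hasP; apply: contraT; rewrite /= orbF !negb_or.
rewrite -!has_predC => /and3P[h1 h2 h3].
have : count (mem [:: r1; r2]) (p1 ++ p2 ++ p3) <= 2.
  rewrite -size_filter; apply: (@uniq_leq_size _ _ [:: r1; r2]); first exact: filter_uniq.
  by move=> a; rewrite mem_filter => /andP[].
rewrite !count_cat; move: h1 h2 h3.
have E p : has (predC (fun a => a \notin [:: r1; r2])) p = (0 < count (mem [:: r1; r2]) p).
  by rewrite -has_count; apply: eq_has => a /=; rewrite negbK.
by rewrite !E; lia.
Qed.

(** Nested conditionals instead of [&&], so that [vm_compute] stops at the first failure. *)
Definition all3 (F : 'I_3 -> bool) : bool :=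
  if F (@Ordinal 3 0 isT) then if F (@Ordinal 3 1 isT) then F (@Ordinal 3 2 isT)
  else false else false.

Lemma all3P F : all3 F -> forall i, F i.
Proof. by rewrite /all3; do 2 (case: ifP => // ?); move=> ?; apply: ord3_ind. Qed.

(* The colours of the cube minus a vertex: [p i] on [v X_i], [rij] on
   [X_i Y_j], [o i] on [Y_i nb_i]. *)
Definition cube_share (p0 p1 p2 o0 o1 o2 r01 r02 r10 r12 r20 r21 w : 'I_3) : bool :=
  [&& (p0 == w) == (o0 == w), (p1 == w) == (o1 == w), (p2 == w) == (o2 == w),
      (r01 == w) == (o2 == w), (r10 == w) == (o2 == w), (r02 == w) == (o1 == w),
      (r20 == w) == (o1 == w), (r12 == w) == (o0 == w) & (r21 == w) == (o0 == w)].

(** Settled by trying all colours, the constraint at a vertex being tested as soon as its colours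
    are chosen. The class of [w] is the one shared with the colouring constant on parallel
    classes. *)
Lemma cube_colorings p0 p1 p2 o0 o1 o2 r01 r02 r10 r12 r20 r21 :
  uniq [:: p0; p1; p2] ->
  uniq [:: p0; r01; r02] -> uniq [:: p1; r10; r12] -> uniq [:: p2; r20; r21] ->
  uniq [:: o0; r10; r20] -> uniq [:: o1; r01; r21] -> uniq [:: o2; r02; r12] ->
  uniq [:: o0; o1; o2] /\
  exists w, cube_share p0 p1 p2 o0 o1 o2 r01 r02 r10 r12 r20 r21 w.
Proof.
have : all3 (fun p0 => all3 (fun p1 => all3 (fun p2 =>
  if uniq [:: p0; p1; p2] then
  all3 (fun r01 => all3 (fun r02 => if uniq [:: p0; r01; r02] then
  all3 (fun r10 => all3 (fun r12 => if uniq [:: p1; r10; r12] then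
  all3 (fun r20 => all3 (fun r21 => if uniq [:: p2; r20; r21] then
  all3 (fun o0 => if uniq [:: o0; r10; r20] then
  all3 (fun o1 => if uniq [:: o1; r01; r21] then
  all3 (fun o2 => if uniq [:: o2; r02; r12] then
    uniq [:: o0; o1; o2] &&
    ~~ all3 (fun w => ~~ cube_share p0 p1 p2 o0 o1 o2 r01 r02 r10 r12 r20 r21 w)
  else true) else true) else true) else true)) else true)) else true)) else true))).
  by vm_compute.
move=> K Up U0 U1 U2 V0 V1 V2.
have {K} := all3P (all3P (all3P K p0) p1) p2; rewrite Up => K.
have {K} := all3P (all3P K r01) r02; rewrite U0 => K.
have {K} := all3P (all3P K r10) r12; rewrite U1 => K.
have {K} := all3P (all3P K r20) r21; rewrite U2 => K.
have {K} := all3P K o0; rewrite V0 => K.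
have {K} := all3P K o1; rewrite V1 => K.
have {K} := all3P K o2; rewrite V2 => /andP[-> N]; split=> //.
move: N; rewrite /all3; case: ifP => [_|/negbFE W _]; last by eexists; exact: W.
case: ifP => [_ /negPn W|/negbFE W _]; by eexists; exact: W.
Qed.

Section Replacement.
Variables (T : finType) (e : rel T) (v : T) (nb : 'I_3 -> T).
Hypotheses (adm : admissible e v) (nb_inj : injective nb).
Hypothesis nbP : forall y, e v y = [exists i, y == nb i].

Local Notation T' := (T + bool * 'I_3)%type.
Local Notation X i := (inr (false, i) : T').
Local Notation Y i := (inr (true, i) : T').

(* [v] is replaced by a cube minus a vertex: [inl v] is the vertex of the cube
   opposite to the missing one, the [X i] are its neighbours, and [Y i],
   the vertex opposite to [X i], inherits the neighbour [nb i] of [v]. *)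
Definition replace_vertex : rel T' := fun a b =>
  match a, b with
  | inl x, inl y => [&& x != v, y != v & e x y]
  | inl x, inr (true, i) | inr (true, i), inl x => x == nb i
  | inl x, inr (false, i) | inr (false, i), inl x => x == v
  | inr (s, i), inr (t, j) => (s != t) && (i != j)
  end.
Local Notation e' := replace_vertex.

Let e_sym := adm_sym adm.
Let e_irr := adm_irr adm.

Let e_nb i : e v (nb i). Proof. by rewrite nbP; apply/existsP; exists i. Qed.

Let nb_v i : nb i != v.
Proof. by apply: contraTneq (e_nb i) => ->; rewrite e_irr. Qed.

(** The inverse of [nb] on the neighbours of [v]; elsewhere the value is immaterial. *)
Let idx x : 'I_3 := locked (odflt ord0 [pick i | nb i == x]).

Let idxK i : idx (nb i) = i.
Proof.
rewrite /idx -lock; case: pickP => [j /eqP /nb_inj //|/(_ i)]; by rewrite eqxx.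
Qed.

Let idx_nb x : e x v -> nb (idx x) = x.
Proof. by rewrite e_sym nbP => /existsP[i /eqP->]; rewrite idxK. Qed.

Lemma replace_sym : symmetric e'.
Proof.
move=> [x|[[] i]] [y|[[] j]] //=; rewrite 1?[j == i]eq_sym // e_sym.
by case: (x == v); case: (y == v).
Qed.

Lemma replace_irr : irreflexive e'.
Proof. by move=> [x|[[] i]] //=; rewrite e_irr !andbF. Qed.

Lemma replace_bip : bipartite e'.
Proof.
have [side sideP] := adm_bip adm.
(* [Y i] takes the side of [v], whose neighbour it inherits, and [X i] the opposite one. *)
exists (fun a => match a with inl x => side x | inr (b, _) => b == side v end).
have sn i : side (nb i) = ~~ side v by have := sideP _ _ (e_nb i); do 2 case: (side _).
move=> [x|[[] i]] [y|[[] j]] //=.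
- by case/and3P => _ _ /sideP.
- by move=> /eqP->; rewrite sn; case: (side v).
- by move=> /eqP->; case: (side v).
- by move=> /eqP->; rewrite sn; case: (side v).
- by move=> _; case: (side v).
- by move=> /eqP->; case: (side v).
- by move=> _; case: (side v).
Qed.

Lemma replace_cubic : three_neighbours e'.
Proof.
have size_rem i : size (rem i (enum 'I_3)) = 2 by rewrite size_rem ?mem_enum // size_enum_ord.
have inr_inj b : injective (fun j : 'I_3 => inr (b, j) : T') by move=> j j' [].
case=> [x|[[] i]].
- have [xv|xv] := eqVneq x v.
    exists [seq X j | j <- enum 'I_3]; rewrite map_inj_uniq // enum_uniq size_map size_enum_ord.
    split=> // -[y|[[] j]] /=; rewrite xv ?eqxx /=.
    - by apply/esym/mapP => -[].
    - by rewrite eq_sym (negbTE (nb_v _)); apply/esym/mapP => -[].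
    - by rewrite mem_map // mem_enum.
  have [s [us ss es]] := adm_cubic adm x.
  (* The neighbours of an old vertex are kept, except that [v] becomes [Y (idx x)]. *)
  pose g y : T' := if y == v then Y (idx x) else inl y.
  have g_inj : injective g.
    move=> y z; rewrite /g; case: (eqVneq y v) => [->|_]; case: (eqVneq z v) => [->|_] //.
    by case.
  exists [seq g y | y <- s]; rewrite map_inj_uniq // size_map; split=> // -[y|[[] j]] /=.
  + rewrite xv /= es; have [->|yv] := eqVneq y v.
      by apply/esym/mapP => -[z _]; rewrite /g; case: eqVneq => // zv [E]; rewrite E eqxx in zv.
    by rewrite -[inl y](_ : g y = _) ?mem_map // /g (negbTE yv).
  + have -> : Y j = (if j == idx x then g v else Y j) by rewrite /g eqxx; case: eqP => // ->.
    have [->|ji] := eqVneq j (idx x).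
      rewrite mem_map // -es; apply/eqP/idP => [->|/idx_nb-> //].
      by rewrite e_sym e_nb.
    apply/eqP/mapP => [xE|[z _]]; first by rewrite xE idxK eqxx in ji.
    by rewrite /g; case: ifP => // _ [E]; rewrite E eqxx in ji.
  + rewrite (negbTE xv); apply/esym/mapP => -[z _].
    by rewrite /g; case: ifP.
- exists (inl (nb i) :: [seq X j | j <- rem i (enum 'I_3)]).
  rewrite /= size_map size_rem map_inj_uniq // rem_uniq ?enum_uniq // andbT.
  split=> //; first by apply/mapP => -[].
  move=> [y|[[] j]]; rewrite /= inE /=.
  + by rewrite orbC; case: mapP => [[]|].
  + by apply/esym/mapP => -[].
  + by rewrite mem_map // mem_rem_uniq ?enum_uniq // !inE mem_enum andbT eq_sym.
- exists (inl v :: [seq Y j | j <- rem i (enum 'I_3)]).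
  rewrite /= size_map size_rem map_inj_uniq // rem_uniq ?enum_uniq // andbT.
  split=> //; first by apply/mapP => -[].
  move=> [y|[[] j]]; rewrite /= inE /=.
  + by rewrite orbC; case: mapP => [[]|].
  + by rewrite mem_map // mem_rem_uniq ?enum_uniq // !inE mem_enum andbT eq_sym.
  + by apply/esym/mapP => -[].
Qed.

Lemma replace_k33 : k33_avoiding e' (inl v).
Proof.
have [k [H [f [Hk fi fe fv]]]] := adm_k33 adm.
exists k, H, (fun i => inl (f i)); split=> //.
  by move=> i j ik jk [] /fi; apply.
move=> p pH /=; rewrite fe // andbT.
by case/and4P: Hk => /allP /(_ p pH) /andP[p1 p2] _ _ _; rewrite !fv.
Qed.

(** The inserted piece, [inl v] included, projects to [v]. If a deleted vertex lies in it, the other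
    old vertices are joined as in the old graph without [v], and every surviving vertex escapes to
    them along one of three disjoint paths. Otherwise the piece is intact and behaves like [v]. *)
Lemma replace_conn : three_connected e'.
Proof.
move=> r1 r2 f Hf.
pose ok a := a \notin [:: r1; r2].
have walk p a : path e' a p -> ok a -> all ok p -> f a = f (last a p).
  elim: p a => //= b p IH a /andP[ab bp] oka /andP[okb okp].
  by rewrite (Hf a b ab oka okb); apply: IH.
pose s (r : T') := if r is inl x then x else v.
have gC x y : x \notin [:: s r1; s r2] -> y \notin [:: s r1; s r2] ->
    (forall x' y', e x' y' -> x' \notin [:: s r1; s r2] -> y' \notin [:: s r1; s r2] ->
      f (inl x') = f (inl y')) -> f (inl x) = f (inl y).
  by move=> nx ny K; apply: (adm_conn adm K).
have sok x : x \notin [:: s r1; s r2] -> ok (inl x).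
  rewrite /ok !inE; apply: contra => /orP[]/eqP <-; by rewrite /= eqxx ?orbT.
have oks x : x != v -> ok (inl x) -> x \notin [:: s r1; s r2].
  move=> xv; rewrite /ok !inE; apply: contra => /orP[]/eqP xs; apply/orP; [left|right].
    by move: xs; case: (r1) => [y ->|r E]; rewrite ?eqxx // E eqxx in xv *.
  by move: xs; case: (r2) => [y ->|r E]; rewrite ?eqxx // E eqxx in xv *.
have [vin|vout] := boolP (v \in [:: s r1; s r2]).
  have old x y : x != v -> y != v -> ok (inl x) -> ok (inl y) -> f (inl x) = f (inl y).
    move=> xv yv /(oks _ xv) nx /(oks _ yv) ny; apply: gC => // x' y' xy' nx' ny'.
    apply: Hf; [|exact: sok|exact: sok]; rewrite /= xy' andbT.
    by apply/andP; split; [apply: contraNneq nx'|apply: contraNneq ny'] => ->.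
  have escape a : ok a -> exists2 x, x != v & ok (inl x) /\ f a = f (inl x).
    move=> oka.
    suff [p pp [[x xv xE] okp]] : exists2 p, path e' a p &
        (exists2 x, x != v & last a p = inl x) /\ all ok p.
      exists x; rewrite // -xE -walk //; split=> //.
      by case/lastP: p okp {pp xE} => // p b; rewrite all_rcons last_rcons => /andP[].
    (* The lists omit the start [a], which survives; the two deleted vertices block at most two of
       them. *)
    have three p1 p2 p3 : uniq (p1 ++ p2 ++ p3) ->
        (forall p, p \in [:: p1; p2; p3] -> path e' a p /\ exists i, last a p = inl (nb i)) ->
        exists2 p, path e' a p & (exists2 x, x != v & last a p = inl x) /\ all ok p.
      move=> U K; have [p /K[pp [i pE]] okp] := disjoint_path_avoiding r1 r2 U.
      by exists p => //; split=> //; exists (nb i).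
    pose i0 := @Ordinal 3 0 isT; pose i1 := @Ordinal 3 1 isT; pose i2 := @Ordinal 3 2 isT.
    case: a oka three => [x|[[] i]] oka three.
    - have [xv|xv] := eqVneq x v; last by exists [::] => //; split=> //; exists x.
      apply: (three [:: X i0; Y i1; inl (nb i1)] [:: X i1; Y i2; inl (nb i2)]
                    [:: X i2; Y i0; inl (nb i0)]).
        by rewrite /= !inE /= !(inj_eq inl_inj) !(inj_eq nb_inj).
      move=> p; rewrite !inE => /or3P[]/eqP->; rewrite /= xv !eqxx; split=> //; eexists; reflexivity.
    - elim/ord3_ind: i oka three => oka three.
      + apply: (three [:: inl (nb i0)] [:: X i1; Y i2; inl (nb i2)] [:: X i2; Y i1; inl (nb i1)]).
          by rewrite /= !inE /= !(inj_eq inl_inj) !(inj_eq nb_inj).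
        move=> p; rewrite !inE => /or3P[]/eqP->; rewrite /= !eqxx; split=> //; eexists; reflexivity.
      + apply: (three [:: inl (nb i1)] [:: X i2; Y i0; inl (nb i0)] [:: X i0; Y i2; inl (nb i2)]).
          by rewrite /= !inE /= !(inj_eq inl_inj) !(inj_eq nb_inj).
        move=> p; rewrite !inE => /or3P[]/eqP->; rewrite /= !eqxx; split=> //; eexists; reflexivity.
      + apply: (three [:: inl (nb i2)] [:: X i0; Y i1; inl (nb i1)] [:: X i1; Y i0; inl (nb i0)]).
          by rewrite /= !inE /= !(inj_eq inl_inj) !(inj_eq nb_inj).
        move=> p; rewrite !inE => /or3P[]/eqP->; rewrite /= !eqxx; split=> //; eexists; reflexivity.
    - elim/ord3_ind: i oka three => oka three.
      + apply: (three [:: Y i1; inl (nb i1)] [:: Y i2; inl (nb i2)]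
                      [:: inl v; X i1; Y i0; inl (nb i0)]).
          by rewrite /= !inE /= !(inj_eq inl_inj) !(inj_eq nb_inj) ![v == _]eq_sym !(negbTE (nb_v _)).
        move=> p; rewrite !inE => /or3P[]/eqP->; rewrite /= !eqxx; split=> //; eexists; reflexivity.
      + apply: (three [:: Y i0; inl (nb i0)] [:: Y i2; inl (nb i2)]
                      [:: inl v; X i2; Y i1; inl (nb i1)]).
          by rewrite /= !inE /= !(inj_eq inl_inj) !(inj_eq nb_inj) ![v == _]eq_sym !(negbTE (nb_v _)).
        move=> p; rewrite !inE => /or3P[]/eqP->; rewrite /= !eqxx; split=> //; eexists; reflexivity.
      + apply: (three [:: Y i0; inl (nb i0)] [:: Y i1; inl (nb i1)]
                      [:: inl v; X i0; Y i2; inl (nb i2)]).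
          by rewrite /= !inE /= !(inj_eq inl_inj) !(inj_eq nb_inj) ![v == _]eq_sym !(negbTE (nb_v _)).
        move=> p; rewrite !inE => /or3P[]/eqP->; rewrite /= !eqxx; split=> //; eexists; reflexivity.
  move=> a b /escape[x xv [okx ->]] /escape[y yv [oky ->]]; exact: old.
(* Now no vertex of the piece is deleted: [f] is constant on it, and an old edge at [v] is replaced
   by one at some [Y i]. *)
have [okX okY] : (forall i, ok (X i)) /\ (forall i, ok (Y i)).
  split=> i; rewrite /ok !inE; apply: contra vout => /orP[]/eqP <-;
    by rewrite !inE eqxx ?orbT.
have okv : ok (inl v) := sok _ vout.
have fX i : f (X i) = f (inl v) by apply: (Hf _ _ _ (okX i) okv); rewrite /= eqxx.
have fY i : f (Y i) = f (inl v).
  have [j ji] : exists j, j != i.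
    by elim/ord3_ind: i; [exists (@Ordinal 3 1 isT)|exists (@Ordinal 3 0 isT)|exists (@Ordinal 3 0 isT)].
  by rewrite -(fX j); apply: (Hf _ _ _ (okY i) (okX j)); rewrite /= eq_sym.
have fE x y : e x y -> ok (inl x) -> ok (inl y) -> f (inl x) = f (inl y).
  wlog yv : x y / y != v.
    move=> W xy okx oky; have [yv|yv] := eqVneq y v; last exact: W.
    have xv : x != v by apply: contraTneq xy => ->; rewrite yv e_irr.
    by apply/esym/W; rewrite // e_sym.
  move=> xy okx oky; have [xv|xv] := eqVneq x v; last by apply: (Hf _ _ _ okx oky); rewrite /= xv yv.
  move: xy; rewrite xv nbP => /existsP[i /eqP yE].
  by rewrite -(fY i); apply: (Hf _ _ _ (okY i) oky); rewrite /= yE.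
have fC a : ok a -> f a = f (inl v).
  case: a => [x|[[] i]] oka; rewrite ?fX ?fY //.
  apply: gC => // [|x' y' xy nx ny]; last by apply: fE => //; exact: sok.
  have [->//|xv] := eqVneq x v; exact: oks.
by move=> a b /fC -> /fC ->.
Qed.

(* The third index, as 0 + 1 + 2 = 0 mod 3; locked because unification would
   otherwise unfold the modular arithmetic. *)
Let third : 'I_3 -> 'I_3 -> 'I_3 := locked (fun i j => - (i + j))%R.

Let thirdC i j : third i j = third j i.
Proof. by rewrite /third -lock GRing.addrC. Qed.

Let third_neq i j : i != j -> third i j != i.
Proof. by rewrite /third -lock; apply/implyP; move: i j; apply: ord3_ind; apply: ord3_ind. Qed.

Let third_inj i : injective (third i).
Proof. by rewrite /third -lock => j k /GRing.oppr_inj /GRing.addrI. Qed.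

(** All edges of the cube in direction [i] get the colour of the edge from [v] to [nb i]; [X i] and
    [Y j] differ in direction [third i j]. *)
Let ext (c : T -> T -> 'I_3) (a b : T') : 'I_3 :=
  match a, b with
  | inl x, inl y => c x y
  | inl _, inr (_, i) | inr (_, i), inl _ => c v (nb i)
  | inr (_, i), inr (_, j) => c v (nb (third i j))
  end.

Let contract (c : T' -> T' -> 'I_3) (x y : T) : 'I_3 :=
  if x == v then c (inl y) (Y (idx y))
  else if y == v then c (inl x) (Y (idx x)) else c (inl x) (inl y).

Let coloring_ext c : coloring e c -> coloring e' (ext c).
Proof.
move=> [cs cp].
have nbc i j : i != j -> c v (nb i) != c v (nb j).
  by move=> ij; apply: cp; rewrite ?e_nb // (inj_eq nb_inj).
have oldE x a : x != v -> e' (inl x) a ->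
    exists2 y, e x y /\ ext c (inl x) a = c x y & a = if y == v then Y (idx x) else inl y.
  move=> xv; case: a => [y|[[] i]] /=.
  - by case/and3P => _ /negbTE yv xy; exists y; rewrite ?yv.
  - move=> /eqP xE; exists v; rewrite ?eqxx xE ?idxK //.
    by split; [rewrite e_sym|apply: cs].
  - by rewrite (negbTE xv).
split.
  move=> [x|[[] i]] [y|[[] j]] //=; try by rewrite thirdC.
  by case/and3P => _ _ /cs.
case=> [x|[[] i]] a b.
- have [->|xv] := eqVneq x v.
    case: a => [y|[[] i]] /=; rewrite ?eqxx //.
      by rewrite eq_sym (negbTE (nb_v i)).
    case: b => [y|[[] j]] //=; rewrite ?eqxx //.
      by rewrite eq_sym (negbTE (nb_v j)).
    move=> _ _ ij; apply: nbc; by apply: contraNneq ij => ->.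
  move=> /(oldE _ _ xv)[y [xy ->] aE] /(oldE _ _ xv)[z [xz ->] bE] ab.
  by apply: cp => //; apply: contraNneq ab => yz; rewrite aE bE yz.
- case: a => [x|[[] j]] //= ; case: b => [y|[[] k]] //=.
  + by move=> /eqP-> /eqP->; rewrite eqxx.
  + by move=> _ ik _; apply: nbc; rewrite eq_sym third_neq.
  + by move=> ij _ _; apply: nbc; rewrite third_neq.
  + by move=> _ _ jk; apply: nbc; rewrite (inj_eq (third_inj (i := i))); apply: contraNneq jk => ->.
- case: a => [x|[[] j]] //= ; case: b => [y|[[] k]] //=.
  + by move=> /eqP-> /eqP->; rewrite eqxx.
  + by move=> _ ik _; apply: nbc; rewrite eq_sym third_neq.
  + by move=> ij _ _; apply: nbc; rewrite third_neq.
  + by move=> _ _ jk; apply: nbc; rewrite (inj_eq (third_inj (i := i))); apply: contraNneq jk => ->.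
Qed.

Let share_ext c d : share_class e c d ->
  share_class e' (ext c) (ext d).
Proof.
move=> [w [w' H]]; exists w, w'.
have Hn i : (c v (nb i) == w) = (d v (nb i) == w') by apply: H.
by move=> [x|[[] i]] [y|[[] j]] //= /and3P[_ _ /H].
Qed.

Section Contract.
Variable c : T' -> T' -> 'I_3.
Hypothesis pc : coloring e' c.

(** The finite check in indexed form: membership in the class of [w] is constant along each parallel
    class. *)
Let cubeP :
  (forall i j, i != j -> c (inl (nb i)) (Y i) != c (inl (nb j)) (Y j)) /\
  exists w, (forall i, (c (inl v) (X i) == w) = (c (inl (nb i)) (Y i) == w)) /\
    forall i j, i != j ->
      (c (X i) (Y j) == w) = (c (inl (nb (third i j))) (Y (third i j)) == w).
Proof.
case: pc => cs cp.
pose i0 := @Ordinal 3 0 isT; pose i1 := @Ordinal 3 1 isT; pose i2 := @Ordinal 3 2 isT.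
pose o i := c (inl (nb i)) (Y i); pose p i := c (inl v) (X i).
pose r i j := c (X i) (Y j).
have oE i : o i = c (Y i) (inl (nb i)) by apply: cs; rewrite /= eqxx.
have pE i : p i = c (X i) (inl v) by apply: cs; rewrite /= eqxx.
have rE i j : i != j -> r i j = c (Y j) (X i) by move=> ij; apply: cs.
have up i j : i != j -> p i != p j.
  by move=> ij; apply: cp; rewrite //= ?eqxx //; apply: contraNneq ij => -[->].
have upr i j : i != j -> p i != r i j.
  by move=> ij; rewrite pE; apply: cp; rewrite //= eqxx.
have urr i j k : i != j -> i != k -> j != k -> r i j != r i k.
  by move=> ij ik jk; apply: cp => //; apply: contraNneq jk => -[->].
have uor i j : i != j -> o j != r i j.
  by move=> ij; rewrite oE rE //; apply: cp; rewrite //= ?eqxx // eq_sym.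
have urr' i j k : i != j -> k != j -> i != k -> r i j != r k j.
  move=> ij kj ik; rewrite !rE //; apply: cp; rewrite /= 1?eq_sym //.
  by apply: contraNneq ik => -[->].
have u3 (a b d : 'I_3) : a != b -> a != d -> b != d -> uniq [:: a; b; d].
  by move=> ab ad bd; rewrite /= !inE negb_or ab ad bd.
have [||||||| U [w W]] := @cube_colorings (p i0) (p i1) (p i2) (o i0) (o i1) (o i2)
    (r i0 i1) (r i0 i2) (r i1 i0) (r i1 i2) (r i2 i0) (r i2 i1);
  try by apply: u3; auto.
split.
  move: U; rewrite /= !inE negb_or andbT => /andP[/andP[h1 h2] h3].
  elim/ord3_ind; elim/ord3_ind=> // _; rewrite -/(o _) // 1?eq_sym -/(o _) //.
exists w; case/and5P: W => /eqP E1 /eqP E2 /eqP E3 /eqP E4.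
case/and5P => /eqP E5 /eqP E6 /eqP E7 /eqP E8 /eqP E9; split.
  by elim/ord3_ind.
have t01 : third i0 i1 = i2 by rewrite /third -lock; apply/eqP.
have t02 : third i0 i2 = i1 by rewrite /third -lock; apply/eqP.
have t12 : third i1 i2 = i0 by rewrite /third -lock; apply/eqP.
have t10 : third i1 i0 = i2 by rewrite /third -lock; apply/eqP.
have t20 : third i2 i0 = i1 by rewrite /third -lock; apply/eqP.
have t21 : third i2 i1 = i0 by rewrite /third -lock; apply/eqP.
by elim/ord3_ind; elim/ord3_ind=> // _; rewrite -?/i0 -?/i1 -?/i2 ?t01 ?t02 ?t12 ?t10 ?t20 ?t21.
Qed.

Lemma coloring_contract : coloring e (contract c).
Proof.
case: pc => cs cp.
split=> [x y xy|x y z xy xz yz].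
  rewrite /contract; case: (eqVneq x v) => [xv|xv]; case: (eqVneq y v) => [yv|yv] //.
    by rewrite xv yv e_irr in xy.
  by apply: cs; rewrite /= xv yv.
rewrite /contract; case: (eqVneq x v) => [xv|xv].
  have [hy hz] : e y v /\ e z v by rewrite -xv !(e_sym _ x).
  have K := cubeP.1 (idx y) (idx z); rewrite (idx_nb hy) (idx_nb hz) in K; apply: K.
  by apply: contraNneq yz => E; rewrite -(idx_nb hy) E idx_nb.
have xY : e x v -> e' (inl x) (Y (idx x)) by move=> xv'; rewrite /= idx_nb.
case: (eqVneq y v) => [yv|yv]; case: (eqVneq z v) => [zv|zv].
- by rewrite yv zv eqxx in yz.
- by apply: cp; [rewrite xY // -yv|rewrite /= xv zv|].
- by apply: cp; [rewrite /= xv yv|rewrite xY // -zv|].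
- by apply: cp; rewrite /= ?xv ?yv ?zv //; apply: contraNneq yz => -[->].
Qed.

Lemma share_contract : share_class e' c (ext (contract c)).
Proof.
have [cs cp] := pc; have [_ [w [W1 W2]]] := cubeP.
exists w, w.
have oE i : contract c v (nb i) = c (inl (nb i)) (Y i).
  by rewrite /contract eqxx idxK.
move=> [x|[[] i]] [y|[[] j]] //= .
- by case/and3P => xv yv _; rewrite /contract (negbTE xv) (negbTE yv).
- by move=> /eqP->; rewrite oE.
- by move=> /eqP->; rewrite oE W1.
- by move=> /eqP->; rewrite oE cs //= eqxx.
- by move=> ij; rewrite oE cs //= W2 1?eq_sym // thirdC.
- by move=> /eqP->; rewrite oE -W1 cs //= eqxx.
- by move=> ij; rewrite oE W2.
Qed.

End Contract.

(** Two colourings are joined through the extensions of their contractions, since [ext] carries the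
    chain between the contractions to the new graph. *)
Lemma replace_color : one_color_class e'.
Proof.
have [[c0 pc0] lk] := adm_color adm.
split; first by exists (ext c0); exact: coloring_ext.
move=> c d pc pd.
have pc1 := coloring_contract pc; have pd1 := coloring_contract pd.
apply: (@linked_trans _ _ _ (ext (contract c))).
  apply: (linked_step (linked_refl _ _)); [exact: coloring_ext|exact: share_contract].
apply: (@linked_trans _ _ _ (ext (contract d))).
  elim: (lk _ _ pc1 pd1) => [|f g _ IH pg fg]; first exact: linked_refl.
  apply: (linked_step IH); first exact: coloring_ext.
  exact: share_ext.
apply: (linked_step (linked_refl _ _)) => //.
by apply: share_class_sym; apply: share_contract.
Qed.

Lemma replace_admissible : admissible e' (inl v).
Proof.
split; [exact: replace_sym|exact: replace_irr|exact: replace_bip|exact: replace_cubic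
  |exact: replace_conn|exact: replace_color|exact: replace_k33].
Qed.

End Replacement.

(** * Base graphs *)

Section Transport.
Variables (T T' : finType) (e : rel T) (v : T) (g : T' -> T) (h : T -> T').
Hypotheses (gK : cancel g h) (hK : cancel h g) (adm : admissible e v).
Let e2 : rel T' := fun x y => e (g x) (g y).

Let coloring_pull c : coloring e2 c -> coloring e (fun x y => c (h x) (h y)).
Proof.
move=> [cs cp]; split=> [x y xy|x y z xy xz yz]; first by apply: cs; rewrite /e2 !hK.
by apply: cp; rewrite /e2 ?hK // (inj_eq (can_inj hK)).
Qed.

Let coloring_push c : coloring e c -> coloring e2 (fun x y => c (g x) (g y)).
Proof.
move=> [cs cp]; split=> [x y xy|x y z xy xz yz]; first exact: cs.
by apply: cp; rewrite // (inj_eq (can_inj gK)).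
Qed.

Lemma admissible_transport : admissible e2 (h v).
Proof.
case: adm => es ei [side sideP] ec e3 [[c0 pc0] lk] [k [H [f [Hk fi fe fv]]]].
split.
- by move=> x y; apply: es.
- by move=> x; apply: ei.
- by exists (side \o g) => x y /sideP.
- move=> x; have [s [us ss sE]] := ec (g x); exists [seq h y | y <- s].
  rewrite (map_inj_uniq (can_inj hK)) size_map; split=> // y.
  by rewrite -{2}[y]gK (mem_map (can_inj hK)) -sE.
- move=> r1 r2 f2 Hf x y; rewrite -[x]gK -[y]gK.
  have E z : (h z \notin [:: r1; r2]) = (z \notin [:: g r1; g r2]).
    by rewrite !inE -{1}[r1]gK -{1}[r2]gK !(inj_eq (can_inj hK)).
  rewrite !E; apply: (e3 _ _ (f2 \o h)) => x' y' xy nx ny /=.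
  by apply: Hf; rewrite ?E // /e2 !hK.
- split; first by exists (fun x y => c0 (g x) (g y)); exact: coloring_push.
  move=> c d pc pd.
  (* Going back and forth returns [c] only pointwise, so a sharing step replaces equality of
     functions. *)
  have share_eq (c1 c2 : T' -> T' -> 'I_3) :
      (forall x y, c1 x y = c2 x y) -> share_class e2 c1 c2.
    by move=> E; exists ord0, ord0 => x y _; rewrite E.
  have := lk _ _ (coloring_pull pc) (coloring_pull pd).
  suff L f2 : linked e (fun x y => c (h x) (h y)) f2 ->
      linked e2 c (fun x y => f2 (g x) (g y)).
    move/L => cd; apply: (linked_step cd pd); apply: share_eq => x y.
    by rewrite !gK.
  elim=> [|f3 f4 _ IH p4 [w [w' W]]].
    apply: (linked_step (linked_refl _ _)).
      exact: (coloring_push (coloring_pull pc)).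
    by apply: share_eq => x y; rewrite !gK.
  apply: (linked_step IH); first exact: coloring_push.
  by exists w, w' => x y /W.
- exists k, H, (h \o f); split=> //.
  + by move=> i j ik jk /= /(can_inj hK); apply: fi.
  + by move=> p pH; rewrite /e2 /= !hK; apply: fe.
  + by move=> i ik /=; rewrite (inj_eq (can_inj hK)) fv.
Qed.

End Transport.

Definition has_admissible n := exists (e : rel 'I_n) v, admissible e v.

Lemma has_admissible_add6 n : has_admissible n -> has_admissible (n + 6).
Proof.
case=> e [v adm].
have [s [us ss sE]] := adm_cubic adm v.
pose nb (i : 'I_3) := nth v s i.
have nb_inj : injective nb.
  by move=> i j /eqP; rewrite nth_uniq ?ss // => /eqP /val_inj.
have nbP y : e v y = [exists i, y == nb i].
  rewrite sE; apply/idP/existsP => [/(nthP v)[i]|[i /eqP->]].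
    by rewrite ss => i3 <-; exists (Ordinal i3).
  by rewrite mem_nth // ss.
have adm' := replace_admissible adm nb_inj nbP.
have cT : #|{: 'I_n + bool * 'I_3}| = n + 6.
  by rewrite card_sum card_prod card_bool !card_ord.
pose g (i : 'I_(n + 6)) := enum_val (cast_ord (esym cT) i).
pose h (x : 'I_n + bool * 'I_3) := cast_ord cT (enum_rank x).
have gK : cancel g h by move=> i; rewrite /g /h enum_valK cast_ordKV.
have hK : cancel h g by move=> x; rewrite /g /h cast_ordK enum_rankK.
exists (fun x y => replace_vertex e v nb (g x) (g y)), (h (inl v)).
exact: admissible_transport adm'.
Qed.

(** * Boolean tests on edge lists and their soundness *)

Section EdgeList.
Variables (N : nat) (EL H : seq (nat * nat)).

Definition nbrs x : seq nat :=
  [seq p.2 | p <- EL & p.1 == x] ++ [seq p.1 | p <- EL & p.2 == x].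

(** Too little fuel could only make the test fail; four units per vertex suffice, as a visited
    vertex pushes three neighbours. *)
Fixpoint dfs_avoiding (bad : seq nat) fuel seen stack : seq nat :=
  if fuel is fuel'.+1 then
    if stack is x :: st then
      if (x \in seen) || (x \in bad) then dfs_avoiding bad fuel' seen st
      else dfs_avoiding bad fuel' (x :: seen) (nbrs x ++ st)
    else seen
  else seen.

(** By symmetry only pairs with [r2 <= r1] are tested; one of 0, 1, 2 survives and starts the
    search. *)
Definition connected_check : bool :=
  all (fun r1 => all (fun r2 => let bad := [:: r1; r2] in
    let seen := dfs_avoiding bad (4 * N.+1) [::] [:: head 0 [seq x <- iota 0 3 | x \notin bad]] in
    all (fun x => (x \in bad) || (x \in seen)) (iota 0 N.+1)) (iota 0 r1.+1)) (iota 0 N.+1).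

(** Edges are listed with the end in the lower half first, so a common end occupies the same
    coordinate. *)
Definition adjacent (p q : nat * nat) : bool := (p.1 == q.1) || (p.2 == q.2).

Fixpoint extensions (acc : seq ((nat * nat) * nat)) (l : seq (nat * nat)) :=
  if l is p :: l' then
    flatten [seq if all (fun q => ~~ (adjacent p q.1 && (q.2 == k))) acc
                 then extensions ((p, k) :: acc) l' else [::] | k <- [:: 0; 1; 2]]
  else [:: acc].

(** Fixing 0, 1, 2 on the first three edges, which share an endpoint, normalises colour
    permutations. The accumulator grows at its head, so colours come out in the order of
    [rev EL]. *)
Definition solutions : seq (seq nat) :=
  [seq map snd a | a <- extensions (rev (zip (take 3 EL) [:: 0; 1; 2])) (drop 3 EL)].

Definition share (s s' : seq nat) : bool :=
  has (fun w => has (fun w' => map (eq_op w) s == map (eq_op w') s') (iota 0 3)) (iota 0 3).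

Fixpoint link_check fuel (seen todo : seq (seq nat)) : bool :=
  if fuel is fuel'.+1 then
    nilp todo ||
    link_check fuel' ([seq s <- todo | has (share^~ s) seen] ++ seen)
                     [seq s <- todo | ~~ has (share^~ s) seen]
  else nilp todo.

(** Each listed colouring is tested anew, so that of [extensions] only completeness has to be
    proved. *)
Definition valid (s : seq nat) : bool :=
  [&& size s == size EL, all (fun k => k < 3) s &
      let z := zip (rev EL) s in
      all (fun p => all (fun q =>
        (adjacent p.1 q.1 && (p.1 != q.1)) ==> (p.2 != q.2)) z) z].

(** Taking the certificate with [N] vertices keeps the subdivision off the last vertex [N]. *)
Definition base_check : bool :=
  [&& uniq EL, all (fun p => (p.1 < N.+1./2) && (N.+1./2 <= p.2 < N.+1)) EL,
      all (fun x => [&& uniq (nbrs x), size (nbrs x) == 3 & all (gtn N.+1) (nbrs x)]) (iota 0 N.+1),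
      connected_check,
      k33_certificate N H && all (fun p => p \in EL) H,
      (if solutions is s0 :: ss then all valid (s0 :: ss) && link_check 10 [:: s0] ss
       else false) &
      if EL is p1 :: p2 :: p3 :: _ then (p1.1 == p2.1) && (p2.1 == p3.1) else false].

Hypothesis chk : base_check.

Definition edge_rel : rel 'I_N.+1 := fun x y =>
  ((x : nat, y : nat) \in EL) || ((y : nat, x : nat) \in EL).

Let uEL : uniq EL. Proof. by case/andP: chk. Qed.

Let ends p : p \in EL -> (p.1 < N.+1./2) && (N.+1./2 <= p.2 < N.+1).
Proof. by case/and3P: chk => _ /allP K _ /K. Qed.

Let lt1 p : p \in EL -> p.1 < N.+1. Proof. by move/ends; lia. Qed.
Let lt2 p : p \in EL -> p.2 < N.+1. Proof. by move/ends; lia. Qed.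

Let swapN x y : (x, y) \in EL -> ((y, x) \in EL) = false.
Proof. by move/ends => /= h1; apply/negP => /ends /= h2; lia. Qed.

Let mem_nbrs x y : (y \in nbrs x) = ((x, y) \in EL) || ((y, x) \in EL).
Proof.
rewrite mem_cat; congr (_ || _); apply/mapP/idP.
- by case=> -[a b]; rewrite mem_filter /= => /andP[/eqP-> ab] ->.
- by exists (x, y); rewrite // mem_filter /= eqxx.
- by case=> -[a b]; rewrite mem_filter /= => /andP[/eqP-> ab] ->.
- by exists (y, x); rewrite // mem_filter /= eqxx.
Qed.

Let er_sym : symmetric edge_rel. Proof. by move=> x y; rewrite /edge_rel orbC. Qed.

Let edge_case x y : edge_rel x y -> exists2 p, p \in EL &
  x = inord p.1 /\ y = inord p.2 \/ x = inord p.2 /\ y = inord p.1.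
Proof.
case/orP => p; eexists; try exact: p; [left|right]; by rewrite !inord_val.
Qed.

Let edge_in p : p \in EL -> edge_rel (inord p.1) (inord p.2).
Proof. by move=> pE; rewrite /edge_rel /= !inordK ?lt1 ?lt2 // -surjective_pairing pE. Qed.

Let inordN_inj i j : i < N.+1 -> j < N.+1 -> (inord i : 'I_N.+1) = inord j -> i = j.
Proof. by move=> iN jN /(congr1 val); rewrite /= !inordK. Qed.

Let base_conn : three_connected edge_rel.
Proof.
move=> r1 r2 f Hf.
wlog r21 : r1 r2 Hf / r2 <= r1.
  move=> W; case: (leqP r2 r1) => [/W|/ltnW r12]; first exact.
  have E x : (x \in [:: r1; r2]) = (x \in [:: r2; r1]) by rewrite !inE orbC.
  move=> x y; rewrite !E; apply: W => // x' y'; rewrite -!E; exact: Hf.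
set bad := [:: val r1; val r2].
have badE x : (x \in [:: r1; r2]) = (val x \in bad) by rewrite !inE.
pose F i := f (inord i).
have FH x y : y \in nbrs x -> x \notin bad -> y \notin bad -> F x = F y.
  rewrite mem_nbrs => xy nx ny.
  have [xN yN] : x < N.+1 /\ y < N.+1.
    by case/orP: xy => xy; have := lt1 xy; have := lt2 xy.
  by apply: Hf; rewrite ?badE /edge_rel /= !inordK.
(* Invariant of the search: [F] has value [b] at every visited vertex and at every stacked one that
   is not deleted. *)
have dfsP b fuel seen st : {in seen, forall x, F x = b} ->
    {in st, forall x, x \in bad \/ F x = b} ->
    {in dfs_avoiding bad fuel seen st, forall x, F x = b}.
  elim: fuel seen st => //= fuel IH seen [|x st] // Hs Hst.
  have Hst' : {in st, forall x, x \in bad \/ F x = b}.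
    by move=> y ys; apply: Hst; rewrite inE ys orbT.
  case: ifP => [_|/norP[nx xb]]; first exact: IH.
  have Fx : F x = b by have [xb'|//] := Hst x (mem_head _ _); rewrite xb' in xb.
  apply: IH => y; first by rewrite inE => /orP[/eqP->|/Hs].
  rewrite mem_cat => /orP[yx|/Hst'//].
  by case yb: (y \in bad); [left|right; rewrite -Fx (FH x y) // yb].
have C : connected_check by case/and5P: chk.
move/allP: C => /(_ (val r1)); rewrite mem_iota ltn_ord => /(_ isT).
move/allP => /(_ (val r2)); rewrite mem_iota ltnS r21 => /(_ isT) /allP C.
set s0 := head 0 _ in C.
have D x : x \notin [:: r1; r2] -> f x = F s0.
  rewrite badE => nx; have := C (val x); rewrite mem_iota ltn_ord => /(_ isT).
  rewrite (negbTE nx) orFb => xs.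
  rewrite -(dfsP (F s0) _ _ _ _ _ _ xs) /F ?inord_val //.
  by move=> y; rewrite inE => /eqP->; right.
by move=> x y /D -> /D ->.
Qed.

Let base_cubic : three_neighbours edge_rel.
Proof.
move=> x; have : val x \in iota 0 N.+1 by rewrite mem_iota /=.
have /allP K : all (fun x => [&& uniq (nbrs x), size (nbrs x) == 3 &
    all (gtn N.+1) (nbrs x)]) (iota 0 N.+1) by case/and4P: chk.
move/K => /and3P[u /eqP s /allP lt].
exists [seq inord y | y <- nbrs x]; split.
- rewrite map_inj_in_uniq // => i j /lt iN /lt jN; exact: inordN_inj.
- by rewrite size_map.
move=> y; rewrite /edge_rel -mem_nbrs; apply/idP/mapP => [yx|[z zx ->]].
  by exists (val y); rewrite ?inord_val.
by rewrite inordK //; exact: lt.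
Qed.

Let base_k33 : k33_avoiding edge_rel ord_max.
Proof.
have /andP[K /allP HE] : k33_certificate N H && all (fun p => p \in EL) H.
  by case/and5P: chk => _ _ _ _ /andP[].
exists N, H, inord; split=> //.
- move=> i j; rewrite -!topredE /= => iN jN; apply: inordN_inj; exact: ltnW.
- by move=> p /HE; exact: edge_in.
- by move=> i iN; apply/eqP => /(congr1 val) /=; rewrite inordK; lia.
Qed.

Let col (c : 'I_N.+1 -> 'I_N.+1 -> 'I_3) (p : nat * nat) : nat := c (inord p.1) (inord p.2).

Let col_adj c p q : coloring edge_rel c -> p \in EL -> q \in EL ->
  adjacent p q -> p != q -> col c p != col c q.
Proof.
move=> [cs cp] pE qE; rewrite (inj_eq val_inj) => /orP[] /eqP pq npq.
  rewrite pq; apply: cp; rewrite ?edge_in // -?pq ?edge_in //.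
  apply: contraNneq npq => /inordN_inj pq2; apply/eqP.
  by rewrite [p]surjective_pairing [q]surjective_pairing pq pq2 ?lt2.
rewrite (cs _ _ (edge_in pE)) (cs _ _ (edge_in qE)) pq.
apply: cp; [by rewrite er_sym -pq edge_in|by rewrite er_sym edge_in|].
apply: contraNneq npq => /inordN_inj pq1; apply/eqP.
by rewrite [p]surjective_pairing [q]surjective_pairing pq pq1 ?lt1.
Qed.

(** The branch that colours each edge as [c] does is never pruned. *)
Let extensions_complete c l done_ : coloring edge_rel c ->
  {subset l ++ done_ <= EL} -> uniq (l ++ done_) ->
  [seq (p, col c p) | p <- catrev l done_] \in
    extensions [seq (p, col c p) | p <- done_] l.
Proof.
move=> pc; elim: l done_ => [|p l IH] done_ sub u; first by rewrite inE.
have u' : uniq (l ++ p :: done_) by rewrite -cat1s uniq_catCA.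
have sub' : {subset l ++ p :: done_ <= EL}.
  by move=> q; rewrite mem_cat inE orbCA => qi; apply: sub; rewrite inE mem_cat.
apply/flattenP; exists (extensions [seq (p, col c p) | p <- p :: done_] l); last exact: IH.
apply/mapP; exists (col c p); first by rewrite /col; case: (c _ _) => -[|[|[|]]].
rewrite ifT //; apply/allP => _ /mapP[q qd ->] /=.
rewrite negb_and -implybE; apply/implyP => pq; rewrite eq_sym.
apply: col_adj => //; try by apply: sub; rewrite inE mem_cat ?qd ?eqxx ?orbT.
by apply: contraTneq u => ->; rewrite /= mem_cat qd orbT.
Qed.

Let of_sol (s : seq nat) (x y : 'I_N.+1) : 'I_3 :=
  let p := (val x, val y) in let q := (val y, val x) in
  inord (nth 0 s (index (if p \in EL then p else q) (rev EL))).

Let of_solE s p : p \in EL ->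
  of_sol s (inord p.1) (inord p.2) = inord (nth 0 s (index p (rev EL))) /\
  of_sol s (inord p.2) (inord p.1) = inord (nth 0 s (index p (rev EL))).
Proof.
move=> pE; rewrite /of_sol /= !inordK ?lt1 ?lt2 // -surjective_pairing pE.
by rewrite swapN -?surjective_pairing.
Qed.

Let inord3_eq i j : i < 3 -> j < 3 -> ((inord i : 'I_3) == inord j) = (i == j).
Proof. by move=> i3 j3; rewrite -val_eqE /= !inordK. Qed.

Let valid_lt s i : valid s -> nth 0 s i < 3.
Proof.
case/and3P => _ /allP K _; case: (ltnP i (size s)) => [/(mem_nth 0)/K//|h].
by rewrite nth_default.
Qed.

Let ix_lt s p : valid s -> p \in EL -> index p (rev EL) < size s.
Proof. by case/and3P => /eqP-> _ _ pE; rewrite -size_rev index_mem mem_rev. Qed.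

Let of_sol_coloring s : valid s -> coloring edge_rel (of_sol s).
Proof.
move=> vs; have [/eqP ss _ V] := and3P vs.
have Vpq p q : p \in EL -> q \in EL -> adjacent p q -> p != q ->
    (inord (nth 0 s (index p (rev EL))) : 'I_3) != inord (nth 0 s (index q (rev EL))).
  move=> pE qE pq npq; rewrite inord3_eq ?valid_lt //.
  have mz r : r \in EL -> (r, nth 0 s (index r (rev EL))) \in zip (rev EL) s.
    move=> rE; have il := ix_lt vs rE.
    apply/(nthP (r, 0)); exists (index r (rev EL)).
      by rewrite size_zip size_rev ss minnn -ss.
    by rewrite nth_zip ?size_rev // nth_index ?mem_rev.
  by move/allP: V => /(_ _ (mz p pE)) /allP /(_ _ (mz q qE)) /=; rewrite pq npq.
split=> [x y /edge_case[p pE]|x y z /edge_case[p pE xy] /edge_case[q qE xz] yz].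
  by have [E1 E2] := of_solE s pE; case=> -[-> ->]; rewrite E1 E2.
have [p1 p2] := of_solE s pE; have [q1 q2] := of_solE s qE.
have [p1N p2N q1N q2N] : [/\ p.1 < N.+1, p.2 < N.+1, q.1 < N.+1 & q.2 < N.+1].
  by rewrite !lt1 ?lt2.
have npq : p.1 <> q.2 /\ p.2 <> q.1 by move/ends: pE; move/ends: qE; lia.
case: xy => -[xp yp]; case: xz => -[xq zq]; move: (xq); rewrite xp => E.
- have {}E := inordN_inj p1N q1N E; rewrite yp p1 zq E q1.
  apply: Vpq => //; first by rewrite /adjacent E eqxx.
  by apply: contraNneq yz => pq; rewrite yp zq pq.
- by case: npq => /(_ (inordN_inj p1N q2N E)).
- by case: npq => _ /(_ (inordN_inj p2N q1N E)).
- have {}E := inordN_inj p2N q2N E; rewrite yp p2 zq E q2.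
  apply: Vpq => //; first by rewrite /adjacent E eqxx orbT.
  by apply: contraNneq yz => pq; rewrite yp zq pq.
Qed.

Let share_of_sol s s' : valid s -> valid s' -> share s s' ->
  share_class edge_rel (of_sol s) (of_sol s').
Proof.
move=> vs vs' /hasP[w]; rewrite mem_iota => w3 /hasP[w']; rewrite mem_iota => w'3 /eqP E.
exists (inord w), (inord w') => x y /edge_case[p pE].
have [p1 p2] := of_solE s pE; have [q1 q2] := of_solE s' pE.
have := congr1 (fun t => nth false t (index p (rev EL))) E.
rewrite !(nth_map 0) ?ix_lt // => EE.
case=> -[-> ->]; rewrite ?p1 ?p2 ?q1 ?q2 !inord3_eq ?valid_lt //.
  by rewrite ![_ == w]eq_sym ![_ == w']eq_sym.
by rewrite ![_ == w]eq_sym ![_ == w']eq_sym.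
Qed.

Let link_checkP c fuel seen todo : link_check fuel seen todo ->
  {in seen, forall s, valid s /\ linked edge_rel c (of_sol s)} -> all valid todo ->
  {in todo, forall s, linked edge_rel c (of_sol s)}.
Proof.
elim: fuel seen todo => [|fuel IH] seen todo /=; first by move/nilP->.
case/orP => [/nilP->//|/IH K] Hs vt.
have Hn s : s \in todo -> has (share^~ s) seen -> linked edge_rel c (of_sol s).
  move=> st /hasP[s' /Hs[vs' ls'] ss']; have vs := allP vt _ st.
  by apply: (linked_step ls'); [exact: of_sol_coloring|exact: share_of_sol].
move=> s st; case hs: (has (share^~ s) seen); first exact: Hn.
apply: K; last by rewrite mem_filter hs.
  move=> t; rewrite mem_cat mem_filter => /orP[/andP[ht tt]|/Hs//].
  by split; [exact: (allP vt)|exact: Hn].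
by apply/allP => t; rewrite mem_filter => /andP[_ /(allP vt)].
Qed.

(** After renaming colours so that the first three edges get 0, 1, 2, any colouring is among
    [solutions], and renaming is itself a sharing step. *)
Let base_color : one_color_class edge_rel.
Proof.
have [s0 [ss [solE /andP[/andP[v0 vss] lc]]]] : exists s0 ss, solutions = s0 :: ss /\
    all valid (s0 :: ss) && link_check 10 [:: s0] ss.
  by case/and5P: chk => _ _ _ _ /and3P[_]; case: solutions => // s0 ss K _; exists s0, ss.
have [p1 [p2 [p3 [E3 [ELE p12 p23]]]]] : exists p1 p2 p3 E3,
    [/\ EL = p1 :: p2 :: p3 :: E3, p1.1 = p2.1 & p2.1 = p3.1].
  case/and5P: chk => _ _ _ _ /and3P[_ _]; case: (EL) => [|p1 [|p2 [|p3 E3]]] //.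
  by case/andP => /eqP h1 /eqP h2; exists p1, p2, p3, E3.
have sol_linked s : s \in solutions -> valid s /\ linked edge_rel (of_sol s0) (of_sol s).
  have l0 : {in [:: s0], forall s, valid s /\ linked edge_rel (of_sol s0) (of_sol s)}.
    by move=> t; rewrite inE => /eqP->; split=> //; exact: linked_refl.
  rewrite solE inE => /orP[/eqP->|st]; first by apply: l0; rewrite inE.
  by split; [exact: (allP vss)|exact: (link_checkP lc l0 vss st)].
have all_linked c : coloring edge_rel c -> linked edge_rel (of_sol s0) c.
  move=> pc.
  have [P1 P2 P3] : [/\ p1 \in EL, p2 \in EL & p3 \in EL].
    by rewrite ELE !inE !eqxx ?orbT.
  have [n12 n13 n23] : [/\ p1 != p2, p1 != p3 & p2 != p3].
    by move: uEL; rewrite ELE /= !inE !negb_or => /and3P[/and3P[-> -> _] /andP[-> _] _].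
  have adj p q : p.1 = q.1 -> adjacent p q by rewrite /adjacent => ->; rewrite eqxx.
  pose ci (p : nat * nat) := c (inord p.1) (inord p.2).
  have c12 : ci p1 != ci p2 by apply: (col_adj pc P1 P2 (adj _ _ p12) n12).
  have c13 : ci p1 != ci p3 by apply: (col_adj pc P1 P3 (adj _ _ (etrans p12 p23)) n13).
  have c23 : ci p2 != ci p3 by apply: (col_adj pc P2 P3 (adj _ _ p23) n23).
  have [f [fI f1 f2 f3]] : exists f : 'I_3 -> 'I_3, [/\ injective f,
      f (ci p1) = 0 :> nat, f (ci p2) = 1 :> nat & f (ci p3) = 2 :> nat].
    move: (ci p1) (ci p2) (ci p3) c12 c13 c23 => a b d ab ad bd.
    exists (fun k => if k == a then inord 0 else if k == b then inord 1 else inord 2).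
    rewrite !eqxx ![_ == a]eq_sym (negbTE ab) (negbTE ad) [_ == b]eq_sym (negbTE bd).
    rewrite !inordK //; split=> // x y.
    have third z : z != a -> z != b -> z = d.
      move: a b d z ab ad bd {x y}.
      by do 4 (apply: ord3_ind => //=); move=> *; apply/eqP.
    case: (eqVneq x a) => xa; case: (eqVneq y a) => ya /=;
      case: (eqVneq x b) => xb; case: (eqVneq y b) => yb /=;
      try (by rewrite xa ya); try (by rewrite xb yb);
      try (by move/(congr1 val); rewrite /= !inordK).
    by move=> _; rewrite (third x) // (third y).
  pose d x y := f (c x y).
  have pd : coloring edge_rel d := coloring_comp fI pc.
  pose s := [seq col d p | p <- rev EL].
  have sS : s \in solutions.
    apply/mapP; exists [seq (p, col d p) | p <- rev EL]; last by rewrite -map_comp.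
    have K := @extensions_complete d E3 [:: p3; p2; p1] pd.
    have acc : [seq (p, col d p) | p <- [:: p3; p2; p1]] = rev (zip (take 3 EL) [:: 0; 1; 2]).
      by rewrite ELE /= take0 /rev /= /col /d f1 f2 f3.
    have dE : drop 3 EL = E3 by rewrite ELE /= drop0.
    have rE : catrev E3 [:: p3; p2; p1] = rev EL by rewrite ELE.
    have pE : perm_eq (E3 ++ [:: p3; p2; p1]) EL.
      rewrite ELE perm_catC -[p1 :: p2 :: _]/([:: p1; p2; p3] ++ E3) perm_cat2r.
      exact: permEl (perm_rev [:: p1; p2; p3]).
    rewrite acc rE -dE in K; apply: K; rewrite dE; last by rewrite (perm_uniq pE).
    by move=> p; rewrite (perm_mem pE).
  have [vs ls] := sol_linked s sS.
  apply: (@linked_trans _ _ _ d); last first.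
    apply: (linked_step (linked_refl _ _)) => //.
    by apply: share_class_sym; exact: share_class_comp.
  apply: (linked_step ls pd); exists ord0, ord0 => x y /edge_case[p pE].
  have [q1 q2] := of_solE s pE; have nthE : nth 0 s (index p (rev EL)) = col d p.
    by rewrite (nth_map (0, 0)) ?index_mem ?mem_rev // nth_index ?mem_rev.
  have E : inord (nth 0 s (index p (rev EL))) = d (inord p.1) (inord p.2).
    by rewrite nthE /col inord_val.
  case=> -[-> ->]; first by rewrite q1 E.
  by rewrite q2 E; case: pd => ds _; rewrite (ds _ _ (edge_in pE)).
split; first by exists (of_sol s0); exact: of_sol_coloring.
move=> c d pc pd; apply: (@linked_trans _ _ _ (of_sol s0)); last exact: all_linked.
by apply: linked_sym; [exact: of_sol_coloring|exact: all_linked].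
Qed.

Lemma base_admissible : has_admissible N.+1.
Proof.
exists edge_rel, ord_max; split; [exact: er_sym| | |exact: base_cubic|exact: base_conn
  |exact: base_color|exact: base_k33].
  by move=> x; apply/negbTE; rewrite /edge_rel orbb; apply/negP => /ends /=; lia.
exists (fun x : 'I_N.+1 => x < N.+1./2) => x y /edge_case[p pE].
by have pN := ends pE; case=> -[-> ->]; rewrite !inordK ?lt1 ?lt2 //; lia.
Qed.

End EdgeList.

(* Found by computer search.  The bipartition is into the lower and the upper
   half of the labels, the first three edges share an endpoint, and the last
   vertex is the one to be replaced. *)
Definition base12 : seq (nat * nat) :=
    [:: (0,11); (0,7); (0,10); (1,10); (5,10); (5,11); (3,11); (5,9); (1,6);
    (1,8); (3,6); (3,8); (2,6); (2,7); (2,9); (4,7); (4,8); (4,9)].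
Definition k33_in_base12 : seq (nat * nat) :=
    [:: (2,9); (4,9); (5,9); (4,7); (4,8); (0,10); (1,10); (1,6); (2,7);
    (5,10); (1,8); (0,7); (2,6)].

Definition base16 : seq (nat * nat) :=
    [:: (4,9); (4,11); (4,14); (0,11); (7,11); (7,14); (3,14); (7,12); (0,13);
    (0,15); (1,9); (1,15); (1,8); (2,9); (2,13); (2,10); (3,8); (3,10); (5,8);
    (5,15); (5,12); (6,10); (6,12); (6,13)].
Definition k33_in_base16 : seq (nat * nat) :=
    [:: (2,10); (3,10); (6,10); (5,12); (7,12); (1,8); (3,8); (3,14); (4,9);
    (2,9); (6,12); (5,8); (7,14); (1,9); (4,14)].

Definition base20 : seq (nat * nat) :=
    [:: (4,10); (4,13); (4,14); (0,10); (9,10); (9,14); (2,14); (9,17);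
    (0,11); (0,18); (2,11); (2,18); (1,11); (3,18); (1,15); (1,19); (3,15);
    (3,19); (6,15); (6,17); (6,12); (7,19); (7,13); (5,13); (5,12); (5,16);
    (7,16); (8,12); (8,16); (8,17)].
Definition k33_in_base20 : seq (nat * nat) :=
    [:: (9,17); (9,10); (9,14); (0,11); (1,11); (2,11); (3,15); (2,18);
    (0,18); (6,17); (6,15); (0,10); (2,14); (1,15); (3,18)].

Lemma base_check12 : base_check 11 base12 k33_in_base12.
Proof. by vm_compute. Qed.
Lemma base_check16 : base_check 15 base16 k33_in_base16.
Proof. by vm_compute. Qed.
Lemma base_check20 : base_check 19 base20 k33_in_base20.
Proof. by vm_compute. Qed.

Lemma has_admissible_even n : ~~ odd n -> 18 <= n -> has_admissible n.
Proof.
move=> evn n18.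
have add b q : has_admissible b -> has_admissible (b + q * 6).
  move=> hb; elim: q => [|q IH]; first by rewrite addn0.
  by rewrite mulSn addnCA addnC; apply: has_admissible_add6.
(* The bases represent the even residues 0, 4, 2 modulo 6; from 18 on, residue 2 first occurs at
   20. *)
have [->|[->|->]] : n = 12 + (n - 12) %/ 6 * 6 \/
    n = 16 + (n - 16) %/ 6 * 6 \/ n = 20 + (n - 20) %/ 6 * 6 by lia.
- exact: add (base_admissible base_check12).
- exact: add (base_admissible base_check16).
- exact: add (base_admissible base_check20).
Qed.

(** * From the invariant to the properties of the graph *)

Section AdmissibleGraph.
Variables (T : finType) (e : rel T) (v : T).
Hypotheses (adm : admissible e v) (cardT : 3 < #|T|).

Lemma admissible_cubic : cubic e.
Proof.
move=> x; have [s [us ss sE]] := adm_cubic adm x.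
by rewrite -ss -(card_uniqP us); apply: eq_card => y; rewrite inE sE.
Qed.

Let has_neighbour x : exists y, e x y.
Proof.
have : 0 < #|[set y | e x y]| by rewrite admissible_cubic.
by case/card_gt0P => y; rewrite inE; exists y.
Qed.

Lemma admissible_connected : cut_connected e.
Proof.
move=> f fe x y; have [->//|xy] := eqVneq x y.
(* Moving to a neighbour [z] of [x] frees [x] to be the deleted vertex. *)
have [z xz] := has_neighbour x; rewrite (fe _ _ xz).
have zx : z != x by apply: contraTneq xz => ->; rewrite (adm_irr adm).
by apply: (adm_conn adm (r1 := x) (r2 := x)) => [a b /fe||]; rewrite ?inE ?orbb // eq_sym.
Qed.

Lemma admissible_k_connected : k_connected e 3.
Proof.
split=> // R R3 x y; rewrite !inE => xR yR.
(* [f] is the indicator of the component of [x] among the surviving vertices. *)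
set r := [rel u w | _]; pose f u := connect r x u.
suff : f x = f y by rewrite /f connect0.
have fe a b : e a b -> a \notin R -> b \notin R -> f a = f b.
  move=> ab aR bR; have rab : r a b by rewrite /= ab !inE aR bR.
  have rba : r b a by rewrite /= (adm_sym adm) ab !inE aR bR.
  by apply/idP/idP => /connect_trans; apply; apply: connect1.
have conn r1 r2 : R = [set r1; r2] -> f x = f y.
  move=> RE; apply: (adm_conn adm (r1 := r1) (r2 := r2)) => [a b ab||].
  - by move=> na nb; apply: fe; rewrite // RE !inE; move: na nb; rewrite !inE.
  - by move: xR; rewrite RE !inE.
  - by move: yR; rewrite RE !inE.
move: R3; rewrite ltnS leq_eqVlt ltnS leq_eqVlt ltnS leqn0 => /or3P[].
- by move=> /cards2P[r1 [r2 [_ /conn]]].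
- by case/cards1P => r1 R1; apply: (conn r1 r1); rewrite setUid.
- rewrite cards_eq0 => /eqP R0; apply: admissible_connected => a b ab.
  by apply: fe; rewrite // R0 inE.
Qed.

Lemma admissible_nonplanar : ~ planar e.
Proof.
case=> sigma [s1 s2 euler]; have [side sideP] := adm_bip adm.
have [k [H [f [Hk fi fe _]]]] := adm_k33 adm.
exact: (k33_subdivision_contradiction (adm_sym adm) (adm_irr adm)
  admissible_connected has_neighbour sideP s1 s2 euler fi fe Hk).
Qed.

End AdmissibleGraph.

Theorem theorem18 (n : nat) :
  ~~ odd n -> 18 <= n ->
  exists e : rel 'I_n,
    [/\ symmetric e, irreflexive e, ~ planar e, bipartite e & k_connected e 3]
    /\ cubic e /\ Kprime3 e = 1.
Proof.
move=> evn n18; have [e [v adm]] := has_admissible_even evn n18.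
have cardn : 3 < #|'I_n| by rewrite card_ord; lia.
exists e; split; last split.
- split; [exact: adm_sym adm|exact: adm_irr adm|exact: admissible_nonplanar adm
    |exact: adm_bip adm|exact: admissible_k_connected adm cardn].
- exact: admissible_cubic adm.
- exact: Kprime3_1 (adm_sym adm) (adm_irr adm) (adm_color adm).
Qed.
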